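(* For all constants $c,s\in(0,1)$ with $s<c$, there exists a constant $s'\in(0,1)$ (depending only on $c,s$) such that for all integer-valued functions $r(\cdot),q(\cdot)$, $$\mathrm{PCP}_{c,s}[r,q]\leq_R \mathrm{PCP}_{1,s'}[r,\,q+O_{s,c}(\log r)]$$ with success probability $1-2^{-\Omega(r)}$. Furthermore, if the proof size of the original PCP is $n$, then the proof size of the resulting PCP is $n+O(2^r)$.
   Context: A verifier is $(r,q)$-restricted if on every input of length $n$ it tosses at most $r(n)$ coins and non-adaptively queries at most $q(n)$ bits of a proof string. $\mathrm{PCP}_{c,s}[r,q]$ is the class of languages $L$ with an $(r,q)$-restricted non-adaptive verifier $V$ such that for $x\in L$ some proof is accepted with probability $\ge c$, and for $x\notin L$ every proof is accepted with probability $\le s$. The proof size is the length of the proof string. A randomized polynomial-time reduction between promise problems $(A_1,B_1)\le_R(A_2,B_2)$ with error probability $p$ is a randomized polynomial-time map $R$ such that if $x\in A_1$ then $R(x)\in A_2$ with probability $\ge 1-p$, and if $x\in B_1$ then $R(x)\in B_2$ with probability $\ge 1-p$. Extended to PCP classes: the statement $\mathrm{PCP}_{c,s}[r,q]\le_R\mathrm{PCP}_{c',s'}[r',q']$ with probability $1-p$ means that the verifier (equivalently its associated constraint-satisfaction instance, one constraint per random string) of a $\mathrm{PCP}_{c,s}[r,q]$ proof system is mapped by a randomized polynomial-time procedure to an $(r',q')$-restricted verifier such that, with probability $\ge 1-p$ over the reduction's randomness, instances of completeness $\ge c$ are mapped to instances of completeness $\ge c'$, and, with probability $\ge 1-p$,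 instances of soundness $\le s$ are mapped to instances of soundness $\le s'$. *)

(* Defs.v *)
From mathcomp Require Import all_boot all_order all_algebra.
From mathcomp Require Import boolp reals.

Set Implicit Arguments.
Unset Strict Implicit.
Unset Printing Implicit Defensive.

(* Non-adaptive verifiers.  The decision predicate of a test is a Boolean
   circuit, not a truth table, so that a description of a verifier stays small
   even when it makes many queries. *)

Inductive gate := GInput of nat | GNand of nat & nat.

Definition gate_val (answers wires : seq bool) (g : gate) : bool :=
  match g with
  | GInput i => nth false answers i
  | GNand j k => ~~ (nth false wires j && nth false wires k)
  end.

(* Gate number i computes wire number i from the previous wires; the output is
   the last wire. *)
Definition circuit_eval (answers : seq bool) (C : seq gate) : bool :=
  last false (foldl (fun w g => rcons w (gate_val answers w g)) [::] C).

Record test := Test { queries : seq nat; decision : seq gate }.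

Definition accepts (proof : seq bool) (t : test) : bool :=
  circuit_eval [seq nth false proof i | i <- queries t] (decision t).

(* A verifier run on one fixed input, i.e. the associated constraint
   satisfaction instance with one constraint per random string. *)
Record instance := Instance {
  coins : nat;
  proof_size : nat;
  test_of : coins.-tuple bool -> test
}.

Definition verifier := seq bool -> instance.

(* The random string has exactly r bits; a verifier tossing fewer coins ignores
   the remaining ones. *)
Definition restricted_instance (r q : nat) (I : instance) : Prop :=
  coins I = r /\
  forall rho : (coins I).-tuple bool,
    size (queries (test_of rho)) <= q /\
    all (fun i => i < proof_size I) (queries (test_of rho)).

Definition restricted (r q : nat -> nat) (V : verifier) : Prop :=
  forall x, restricted_instance (r (size x)) (q (size x)) (V x).

Definition Pr (R : realType) (T : finType) (P : T -> Prop) : R :=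
  (#|[set x | `[< P x >]]|%:R / #|T|%:R)%R.

Definition completeness_ge (R : realType) (c : R) (I : instance) : Prop :=
  exists proof : (proof_size I).-tuple bool,
    (c <= Pr R (fun rho : (coins I).-tuple bool =>
                  accepts proof (test_of rho)))%R.

Definition soundness_le (R : realType) (s : R) (I : instance) : Prop :=
  forall proof : (proof_size I).-tuple bool,
    (Pr R (fun rho : (coins I).-tuple bool =>
             accepts proof (test_of rho)) <= s)%R.

Definition encode_gate (g : gate) : seq nat :=
  match g with
  | GInput i => [:: 0; i; 0]
  | GNand j k => [:: 1; j; k]
  end.

Definition encode_test (t : test) : seq nat :=
  size (queries t) :: queries t ++
  size (decision t) :: flatten (map encode_gate (decision t)).

Definition encode (I : instance) : seq nat :=
  coins I :: proof_size I ::
  flatten [seq encode_test (test_of rho) | rho <- enum {: (coins I).-tuple bool}].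

Definition bit_size (xs : seq nat) : nat :=
  \sum_(x <- xs) (trunc_log 2 x).+1.

(* Probabilistic random access machines with structured control.  Every
   instruction has unit cost; as addition and (truncated) subtraction are the
   only arithmetic operations and output is written one number at a time,
   polynomial time in the bit size of the input is the same as on Turing
   machines. *)

Inductive com :=
  | Skip
  | Const of nat & nat
  | Add of nat & nat & nat
  | Sub of nat & nat & nat
  | Fetch of nat & nat
  | Store of nat & nat
  | Toss of nat
  | Emit of nat
  | Seq of com & com
  | If of nat & com & com
  | While of nat & com.

Record state := State {
  reg : nat -> nat;
  mem : nat -> nat;
  tape : seq bool;
  out : seq nat
}.

Definition upd (f : nat -> nat) (x v : nat) : nat -> nat :=
  fun y => if y == x then v else f y.

Definition set_reg (x v : nat) (st : state) : state :=
  State (upd (reg st) x v) (mem st) (tape st) (out st).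

Inductive exec : com -> state -> nat -> state -> Prop :=
  | ExecSkip st : exec Skip st 1 st
  | ExecConst x n st : exec (Const x n) st 1 (set_reg x n st)
  | ExecAdd x y z st :
      exec (Add x y z) st 1 (set_reg x (reg st y + reg st z) st)
  | ExecSub x y z st :
      exec (Sub x y z) st 1 (set_reg x (reg st y - reg st z) st)
  | ExecFetch x y st :
      exec (Fetch x y) st 1 (set_reg x (mem st (reg st y)) st)
  | ExecStore x y st :
      exec (Store x y) st 1
        (State (reg st) (upd (mem st) (reg st x) (reg st y)) (tape st) (out st))
  | ExecToss x st :
      exec (Toss x) st 1
        (State (upd (reg st) x (head false (tape st)))
               (mem st) (behead (tape st)) (out st))
  | ExecEmit x st :
      exec (Emit x) st 1
        (State (reg st) (mem st) (tape st) (rcons (out st) (reg st x)))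
  | ExecSeq a b st t1 st1 t2 st2 :
      exec a st t1 st1 -> exec b st1 t2 st2 ->
      exec (Seq a b) st (t1 + t2) st2
  | ExecIfTrue x a b st t st1 :
      reg st x != 0 -> exec a st t st1 -> exec (If x a b) st t.+1 st1
  | ExecIfFalse x a b st t st1 :
      reg st x = 0 -> exec b st t st1 -> exec (If x a b) st t.+1 st1
  | ExecWhileFalse x a st :
      reg st x = 0 -> exec (While x a) st 1 st
  | ExecWhileTrue x a st t1 st1 t2 st2 :
      reg st x != 0 -> exec a st t1 st1 -> exec (While x a) st1 t2 st2 ->
      exec (While x a) st (t1 + t2).+1 st2.

(* The input sits in memory cells 0, 1, 2, ... and its length in register 0. *)
Definition init (xs : seq nat) (w : seq bool) : state :=
  State (upd (fun=> 0) 0 (size xs)) (nth 0 xs) w [::].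

Definition time_bound (k : nat) (I : instance) : nat :=
  k + bit_size (encode I) ^ k.

(* Randomized polynomial-time maps on instances.  The random tape is as long as
   the time bound, hence is never exhausted, whatever its contents. *)
Record rptime_map := RPTimeMap {
  rp_fun :> instance -> seq bool -> instance;
  rp_prog : com;
  rp_deg : nat;
  rp_correct : forall (I : instance) (w : (time_bound rp_deg I).-tuple bool),
    exists t st, [/\ exec rp_prog (init (encode I) w) t st,
                     t <= time_bound rp_deg I
                   & out st = encode (rp_fun I w)]
}.

Definition rp_coins (A : rptime_map) (I : instance) : nat :=
  time_bound (rp_deg A) I.

(* A witnesses PCP_{c,s}[r,q] <=_R PCP_{c',s'}[r',q'] with error probability p,
   where p is a function of the length of the verifier's input. *)
Definition pcp_reduction (R : realType) (A : rptime_map)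
    (c s : R) (r q : nat -> nat) (c' s' : R) (r' q' : nat -> nat)
    (p : nat -> R) : Prop :=
  forall V : verifier, restricted r q V -> forall x : seq bool,
  [/\ forall w : (rp_coins A (V x)).-tuple bool,
        restricted_instance (r' (size x)) (q' (size x)) (A (V x) w),
      completeness_ge c (V x) ->
        (1 - p (size x) <=
         Pr R (fun w : (rp_coins A (V x)).-tuple bool =>
                 completeness_ge c' (A (V x) w)))%R
    & soundness_le s (V x) ->
        (1 - p (size x) <=
         Pr R (fun w : (rp_coins A (V x)).-tuple bool =>
                 soundness_le s' (A (V x) w)))%R].

(* Main.v *)
(* Random strings are read as tests; m = 2^r of them.  The new proof consists of
   the old one, a claimed verdict for each test (level 0), and levels 1, ..., h
   of m/2, m/4, ..., m/2^h bits.  Every bit of level k+1 is meant to be the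
   threshold, at rate (c+s)/2, of d bits of level k drawn at random by the
   reduction.  Test i checks its own claimed verdict, one gate of every level,
   and that its bit of level h is 1.

   Completeness: a random threshold gate raises a fraction c of ones to nearly 1,
   after which the fraction of zeros is at least squared at every level, so that
   h = log r levels leave no zero at all, except with probability 2^-r.
   Soundness: with the same probability, every set of density s + eta in level k
   turns on at most a fraction s of the gates of level k+1 (a union bound over all
   sets, affordable because the levels shrink only by a factor 2 while d is a large
   constant).  If fewer than a fraction eta of the tests reject, then at most a
   fraction eta of the gates of each level cheats, so the density stays below
   s + eta up to the top level, which would have to be all ones.

   For r below a constant a single level suffices, since C log r may then exceed d;
   for r <= 1, where no extra query is allowed, an error of 1/2 is tolerated and a
   coin flip between a trivially true and a trivially false instance does. *)
Require Import Defs.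
From mathcomp Require Import all_boot all_order all_algebra archimedean.
From mathcomp Require Import boolp reals sequences exp.
From mathcomp Require Import zify ring lra.

Set Implicit Arguments.
Unset Strict Implicit.
Unset Printing Implicit Defensive.
Import Order.TTheory GRing.Theory Num.Theory.

(** * Averages over random bit strings *)

Section Average.
Variable R : realType.
Local Open Scope ring_scope.
Implicit Types (f g : seq bool -> R) (n a b : nat).

(** The order of quantifiers shapes the two halves. The wiring is already fixed when the prover
    fills in the levels, so soundness is needed for all sets at once: a layer of [N] gates reads
    [2 * N] bits, hence [2 ^ (2 * N)] sets, and independent gates pay for this union bound because
    one gate errs with probability at most [2 ^ - b] for a large constant [b]. For completeness the
    old proof is fixed before the wiring is drawn, so the honest levels can be followed one layer at
    a time, each from fresh bits, with no union over sets. Checks are one-sided: a bit claimed 0 is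
    never questioned, so soundness only has to limit the spread of ones. Test [i] watches gate [i]
    modulo the size of each level; every gate of a level is thus watched by equally many tests, and
    a fraction of cheating gates costs the same fraction of rejecting tests. The reduction may
    tabulate the whole wiring because its input lists all [2 ^ r] tests, which makes [2 ^ r]
    polynomial in the input size. *)

Fixpoint avg n f : R :=
  if n is n'.+1 then
    (avg n' (fun u => f (true :: u)) + avg n' (fun u => f (false :: u))) / 2
  else f [::].

Lemma avg_le n f g :
  (forall u, size u = n -> f u <= g u) -> avg n f <= avg n g.
Proof.
elim: n f g => [|n IH] f g fg /=; first exact: fg.
rewrite ler_pM2r ?invr_gt0 ?ltr0n //.
by apply: lerD; apply: IH => u su; apply: fg; rewrite /= su.
Qed.

Lemma eq_avg n f g :
  (forall u, size u = n -> f u = g u) -> avg n f = avg n g.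
Proof. move=> fg; apply: le_anti; apply/andP.
by split; apply: avg_le => u /fg ->. Qed.

Lemma avg_const n (x : R) : avg n (fun=> x) = x.
Proof. by elim: n => //= n ->; lra. Qed.

Lemma avgD n f g : avg n (fun u => f u + g u) = avg n f + avg n g.
Proof. by elim: n f g => //= n IH f g; rewrite !IH -mulrDl addrACA. Qed.

Lemma avgZ n (x : R) f : avg n (fun u => x * f u) = x * avg n f.
Proof. by elim: n f => //= n IH f; rewrite !IH -mulrDr mulrA. Qed.

Lemma avg_sum n (I : Type) (s : seq I) (F : I -> seq bool -> R) :
  avg n (fun u => \sum_(i <- s) F i u) = \sum_(i <- s) avg n (F i).
Proof.
elim: s => [|i s IH].
  rewrite big_nil -[RHS](avg_const n); apply: eq_avg => u _; exact: big_nil.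
rewrite big_cons -IH -avgD; apply: eq_avg => u _; exact: big_cons.
Qed.

(** Independence of disjoint stretches of tape is used in this iterated form throughout; it is the
    reason for defining [avg] by recursion on the tape. *)
Lemma avg_cat a b f :
  avg (a + b) f = avg a (fun u => avg b (fun v => f (u ++ v))).
Proof. by elim: a f => //= a IH f; rewrite !IH. Qed.

Lemma avg_drop a n f :
  (a <= n)%N -> avg n (fun w => f (drop a w)) = avg (n - a) f.
Proof.
move=> an; rewrite -{1}(subnKC an) avg_cat -[RHS](avg_const a).
apply: eq_avg => u su; apply: eq_avg => v _; by rewrite drop_size_cat.
Qed.

(** Measurability with respect to the first [a] bits of the tape. *)
Definition reads (T : Type) a (X : seq bool -> T) :=
  forall u v, size u = a -> X (u ++ v) = X u.

Lemma avg_reads a n f : (a <= n)%N -> reads a f -> avg n f = avg a f.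
Proof.
move=> an rf; rewrite -(subnKC an) avg_cat; apply: eq_avg => u su.
by rewrite -[RHS](avg_const (n - a)); apply: eq_avg => v _; apply: rf.
Qed.

Lemma avg_tuple n f :
  avg n f = (\sum_(w : n.-tuple bool) f w) / 2 ^+ n.
Proof.
elim: n f => [|n IH] f /=.
  rewrite expr0 divr1 (big_pred1 [tuple]) // => w.
  by apply/esym/eqP/val_inj; rewrite /= tuple0.
pose h (p : bool * n.-tuple bool) := cons_tuple p.1 p.2.
have hb : bijective h.
  exists (fun w => (thead w, [tuple of behead w])).
    by case=> b w; congr (_, _); apply: val_inj.
  by move=> w; rewrite [w in RHS]tuple_eta; apply: val_inj.
rewrite (reindex h) /=; last exact: onW_bij.
rewrite -(pair_bigA _ (fun (b : bool) (w : n.-tuple bool) => f (b :: w))) /= !IH.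
by rewrite big_bool -mulrDl exprSr invfM mulrA.
Qed.

Lemma Pr_avg n (P : seq bool -> Prop) :
  Pr R (fun w : n.-tuple bool => P w) = avg n (fun w => (`[< P w >])%:R).
Proof.
rewrite avg_tuple /Pr card_tuple card_bool natrX; congr (_ / _).
rewrite -sum1_card natr_sum big_mkcond /=.
by apply: eq_bigr => w _; rewrite inE; case: `[< P w >].
Qed.

End Average.

(** * Independent draws from the tape and their upper tail *)

Section Draws.

Fixpoint draws (T : Type) (X : seq bool -> T) (a N : nat) (u : seq bool) : seq T :=
  if N is N'.+1 then X u :: draws X a N' (drop a u) else [::].

Lemma size_draws (T : Type) (X : seq bool -> T) a N u : size (draws X a N u) = N.
Proof. by elim: N u => //= N IH u; rewrite IH. Qed.

Lemma nth_draws (T : Type) (x0 : T) (X : seq bool -> T) a N u g :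
  g < N -> nth x0 (draws X a N u) g = X (drop (g * a) u).
Proof.
elim: N u g => // N IH u [|g] gN /=; first by rewrite mul0n drop0.
by rewrite IH // drop_drop mulSn addnC.
Qed.

Lemma reads_draws (T : Type) (X : seq bool -> T) a N :
  reads a X -> reads (N * a) (draws X a N).
Proof.
move=> rX; elim: N => [|N IH] u v //= su.
have su1 : size (take a u) = a.
  by apply: size_takel; rewrite su mulSn leq_addr.
congr (_ :: _).
  by rewrite -(cat_take_drop a u) -catA !rX.
rewrite -{1}(cat_take_drop a u) -catA drop_size_cat // IH //.
by rewrite size_drop su mulSn addKn.
Qed.

(* A toss on the exhausted tape returns [false]. *)
Definition num (B : nat) (u : seq bool) : nat :=
  foldl (fun v (b : bool) => v + v + b) 0 (mkseq (nth false u) B).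

Lemma numS B u : num B.+1 u = num B u + num B u + nth false u B.
Proof. by rewrite /num mkseqS foldl_rcons. Qed.

Lemma num_lt B u : num B u < 2 ^ B.
Proof.
elim: B => // B IH; rewrite numS expnS; case: (nth _ _ _); lia.
Qed.

Lemma reads_num B : reads B (num B).
Proof.
move=> u v su; rewrite /num; congr foldl; apply/eq_in_map => i.
by rewrite mem_iota add0n => /= iB; rewrite nth_cat su iB.
Qed.

Variable R : realType.
Local Open Scope ring_scope.

Lemma avg_num B (f : nat -> R) :
  avg B (fun u => f (num B u)) = (\sum_(v < 2 ^ B) f v) / 2 ^+ B.
Proof.
(* Generalised over the accumulator: the first bit turns [x] into [2x] or [2x + 1], and these two
   cases are the two halves of the range of [v]. *)
have gen x : avg B (fun u => f (foldl (fun v (b : bool) => v + v + b)%N x u)) =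
    (\sum_(v < 2 ^ B) f (x * 2 ^ B + v)%N) / 2 ^+ B.
  elim: B x => [|B IH] x /=.
    by rewrite expn0 big_ord1 muln1 addn0 expr0 divr1.
  rewrite !IH -mulrDl exprSr invfM -mulrA [_^-1 * _^-1]mulrC; congr (_ * _).
  have e2 : (2 ^ B.+1 = 2 ^ B + 2 ^ B)%N by rewrite expnS mul2n addnn.
  rewrite e2 big_split_ord /= addrC; congr (_ + _); apply: eq_bigr => i _;
    congr f; rewrite /=; lia.
have := gen 0%N; rewrite mul0n => <-.
by apply: eq_avg => u su; rewrite /num -su mkseq_nth.
Qed.

(** Markov's inequality for [l ^ count]. The tilt [l] stays free: it is 4 for counts well above a
    known mean, a power of two for rare events, and an exponential when two constant rates are
    compared. *)
Lemma draws_tail (T : Type) (X : seq bool -> T) a N (P : pred T) (p l : R) k :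
  reads a X -> 1 <= l -> 
  avg a (fun u => (P (X u))%:R) <= p ->
  avg (N * a) (fun u => (k <= count P (draws X a N u))%N%:R) <=
    (1 + p * (l - 1)) ^+ N / l ^+ k.
Proof.
move=> rX l1 Pp; have l0 : 0 < l by apply: lt_le_trans l1.
have p0 : 0 <= p.
  by apply: le_trans Pp; rewrite -(avg_const a 0); apply: avg_le => u _; rewrite ler0n.
have mgf : avg (N * a) (fun u => l ^+ count P (draws X a N u)) <=
    (1 + p * (l - 1)) ^+ N.
  elim: N => [|N IH] /=; first by rewrite expr0.
  rewrite mulSn avg_cat exprS.
  apply: (@le_trans _ _ (avg a (fun u => l ^+ P (X u) * (1 + p * (l - 1)) ^+ N))).
    apply: avg_le => u su; rewrite -(@eq_avg _ _
      (fun v => l ^+ P (X u) * l ^+ count P (draws X a N v))).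
      by rewrite avgZ ler_wpM2l // exprn_ge0 // ltW.
    by move=> v _; rewrite drop_size_cat // exprD rX.
  have -> : avg a (fun u => l ^+ P (X u) * (1 + p * (l - 1)) ^+ N) =
     (1 + (l - 1) * avg a (fun u => (P (X u))%:R)) * (1 + p * (l - 1)) ^+ N.
    rewrite -avgZ; set A := avg a _; set A' := avg a _.
    have -> : 1 + A' = avg a (fun=> 1) + A' by rewrite avg_const.
    rewrite -avgD mulrC -avgZ.
    apply: eq_avg => u _; rewrite mulrC; congr (_ * _).
    by case: (P _) => /=; ring.
  apply: ler_wpM2r.
    by rewrite exprn_ge0 // addr_ge0 // mulr_ge0 // subr_ge0.
  by rewrite lerD2l mulrC ler_wpM2r // subr_ge0.
rewrite ler_pdivlMr ?exprn_gt0 //; apply: le_trans mgf.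
rewrite mulrC -avgZ; apply: avg_le => u _.
case: leqP => /= [kc|_]; rewrite ?mulr1 ?mulr0 ?exprn_ge0 ?(ltW l0) //.
by rewrite ler_weXn2l.
Qed.

End Draws.

(** * Random wirings *)

Definition ones (S : pred nat) (n : nat) : nat := \sum_(v < n) S v.

Definition gate_row (d B : nat) : seq bool -> seq nat := draws (num B) B d.
Definition layer (d B : nat) : seq bool -> seq (seq nat) :=
  draws (gate_row d B) (d * B) (2 ^ B.-1).
Definition layer_bits (d B : nat) : nat := 2 ^ B.-1 * (d * B).

Lemma reads_layer d B : reads (layer_bits d B) (layer d B).
Proof. by apply/reads_draws/reads_draws/reads_num. Qed.

Fixpoint tape_at (d r k : nat) (w : seq bool) : seq bool :=
  if k is k'.+1 then tape_at d r.-1 k' (drop (layer_bits d r) w) else w.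

Definition wiring (d r : nat) (w : seq bool) (k : nat) : seq (seq nat) :=
  layer d (r - k) (tape_at d r k w).

Fixpoint level (d t r : nat) (S : pred nat) (w : seq bool) (k : nat) : pred nat :=
  if k is k'.+1 then
    fun g => t <= count (level d t r S w k') (nth [::] (wiring d r w k') g)
  else S.

Lemma tape_atS d r k w :
  tape_at d r k.+1 w = drop (layer_bits d (r - k)) (tape_at d r k w).
Proof.
elim: k r w => [|k IH] r w; first by rewrite subn0.
have -> : r - k.+1 = r.-1 - k by lia.
by rewrite [RHS]/= -IH.
Qed.

Lemma tape_at_drop d r k w :
  tape_at d r k w = drop (\sum_(j < k) layer_bits d (r - j)) w.
Proof.
elim: k => [|k IH]; first by rewrite big_ord0 drop0.
by rewrite tape_atS IH drop_drop big_ord_recr addnC.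
Qed.

Lemma size_wiring d r w k : size (wiring d r w k) = 2 ^ (r - k).-1.
Proof. exact: size_draws. Qed.

Lemma nth_wiring d r w k g : g < 2 ^ (r - k).-1 ->
  nth [::] (wiring d r w k) g =
    gate_row d (r - k) (drop (g * (d * (r - k))) (tape_at d r k w)).
Proof. exact: nth_draws. Qed.

(** [level] is unfolded from the top, whereas conditioning on the tape in reading order removes the
    bottom layer first. *)
Lemma levelSr d t r S w k :
  level d t r S w k.+1 =
  level d t r.-1 (level d t r S w 1) (drop (layer_bits d r) w) k.
Proof.
elim: k => [|k IH] //.
rewrite [LHS]/= -/(level d t r S w k.+1) IH.
by rewrite /wiring; have -> : r - k.+1 = r.-1 - k by lia.
Qed.

Lemma ones_count (P : pred (seq nat)) (s : seq (seq nat)) :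
  ones (fun g => P (nth [::] s g)) (size s) = count P s.
Proof.
rewrite /ones -sum1_count (big_nth [::]) big_mkord [RHS]big_mkcond.
by apply: eq_bigr => i _; case: (P _).
Qed.

Section Tails.
Variable R : realType.
Local Open Scope ring_scope.

Lemma row_tail d B (S : pred nat) (p l : R) k :
  1 <= l -> (ones S (2 ^ B))%:R <= p * 2 ^+ B ->
  avg (d * B) (fun u => (k <= count S (gate_row d B u))%N%:R) <=
    (1 + p * (l - 1)) ^+ d / l ^+ k.
Proof.
move=> l1 Sp; apply: draws_tail => //; first exact: reads_num.
rewrite (avg_num B (fun v => (S v)%:R)) ler_pdivrMr ?exprn_gt0 //.
by rewrite -natr_sum.
Qed.

Lemma layer_tail d B (P : pred (seq nat)) (p l : R) k :
  1 <= l -> avg (d * B) (fun u => (P (gate_row d B u))%:R) <= p ->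
  avg (layer_bits d B) (fun u => (k <= count P (layer d B u))%N%:R) <=
    (1 + p * (l - 1)) ^+ (2 ^ B.-1) / l ^+ k.
Proof.
by move=> l1 Pp; apply: draws_tail => //; apply/reads_draws/reads_num.
Qed.

Lemma avg_ge0 n (f : seq bool -> R) : (forall u, 0 <= f u) -> 0 <= avg n f.
Proof. by move=> f0; rewrite -(avg_const n 0); apply: avg_le. Qed.

Lemma avg_le1 n (P : pred (seq bool)) : avg n (fun u => (P u)%:R) <= 1 :> R.
Proof. by rewrite -[leRHS](avg_const n); apply: avg_le => u _; rewrite lern1 leq_b1. Qed.

(** Condition on the bottom layer. Either it produces too many zeros, which costs [b 0], or its
    output is a fixed set within the bound [E 1] and the rest of the tape is fresh, so that
    induction applies with [r] lowered by one. *)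
Lemma level_fail d t (E : nat -> nat) (b : nat -> R) r h S n :
  (forall l (S' : pred nat), (l < h)%N ->
     (ones (predC S') (2 ^ (r - l)) <= E l)%N ->
     avg (layer_bits d (r - l)) (fun u =>
       (E l.+1 < count (fun q => (count S' q < t)%N) (layer d (r - l) u))%N%:R)
     <= b l) ->
  (ones (predC S) (2 ^ r) <= E 0)%N ->
  (h <= r)%N ->
  (\sum_(j < h) layer_bits d (r - j) <= n)%N ->
  avg n (fun w => (E h < ones (predC (level d t r S w h)) (2 ^ (r - h)))%N%:R)
    <= \sum_(l < h) b l.
Proof.
elim: h E b r S n => [|h IH] E b r S n step S0 hr hn.
  rewrite big_ord0 subn0 /= ltnNge S0 /= avg_const //.
rewrite big_ord_recl.
have r0 : (0 < r)%N by case: r hr {step S0 hn}.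
rewrite big_ord_recl subn0 in hn.
have bn : (layer_bits d r <= n)%N by apply: leq_trans hn; apply: leq_addr.
rewrite -(subnKC bn) avg_cat.
pose Z u := (E 1 < count (fun q => (count S q < t)%N) (layer d r u))%N.
apply: (@le_trans _ _ (avg (layer_bits d r) (fun u => (Z u)%:R + \sum_(i < h) b (bump 0 i)))).
  apply: avg_le => u su.
  have rl := @reads_layer d r.
  have eqS v : ones (predC (level d t r S (u ++ v) 1)) (2 ^ r.-1) =
      count (fun q => (count S q < t)%N) (layer d r u).
    rewrite -ones_count size_draws; apply: eq_bigr => i _.
    by rewrite /= ltnNge /wiring subn0 /= rl.
  case Zu: (Z u).
    apply: (@le_trans _ _ 1); first exact: avg_le1.
    rewrite lerDl; apply: sumr_ge0 => i _.
    (* Each [b] is nonnegative: the set without zeros meets every bound [E], so [step] applies to it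
       and bounds a nonnegative average. *)
    have z0 : ones (predC predT) (2 ^ (r - bump 0 i)) = 0%N by rewrite /ones big1.
    apply: le_trans (step (bump 0 i) predT _ _); last by rewrite z0.
      by apply: avg_ge0 => *; rewrite ler0n.
    by rewrite /bump add1n ltnS ltn_ord.
  rewrite add0r.
  have -> : avg (n - layer_bits d r) (fun v =>
     (E h.+1 < ones (predC (level d t r S (u ++ v) h.+1)) (2 ^ (r - h.+1)))%N%:R) =
     avg (n - layer_bits d r) (fun v =>
     (E h.+1 < ones (predC (level d t r.-1 (level d t r S u 1) v h)) (2 ^ (r.-1 - h)))%N%:R) :> R.
    apply: eq_avg => v _; rewrite levelSr drop_size_cat //.
    have -> : level d t r S (u ++ v) 1 = level d t r S u 1.
      by apply/funext => g; rewrite /= /wiring subn0 /= rl // -[u in RHS]cats0 rl.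
    by have -> : (r - h.+1 = r.-1 - h)%N by lia.
  apply: (IH (fun l => E l.+1) (fun l => b l.+1)).
  - move=> l S' lh; have := step l.+1 S' lh.
    by have -> : (r - l.+1 = r.-1 - l)%N by lia.
  - have := eqS [::]; rewrite cats0 => ->.
    by move/negbT: Zu; rewrite -leqNgt.
  - lia.
  - rewrite leq_subRL //; apply: leq_trans hn; rewrite leq_add2l.
    by apply: eq_leq; apply: eq_bigr => i _; congr layer_bits; rewrite /= /bump; lia.
rewrite avgD avg_const lerD2r.
by have := step 0%N S isT; rewrite subn0; apply.
Qed.

End Tails.

(** * Tail estimates *)

Section Chernoff.
Variable R : realType.
Local Open Scope ring_scope.

Lemma expR_le_inv (x : R) : x < 1 -> expR x <= (1 - x)^-1.
Proof.
move=> x1; rewrite -[x]opprK expRN opprK lef_pV2 ?posrE ?expR_gt0 //.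
  by apply: le_trans (expR_ge1Dx _).
by rewrite subr_gt0.
Qed.

Lemma expR_half_le2 : expR 2^-1 <= 2 :> R.
Proof.
apply: (le_trans (expR_le_inv _)); first by lra.
have -> : 1 - 2^-1 = 2^-1 :> R by lra.
by rewrite invrK.
Qed.

Lemma expr_1D_le_expR (x : R) n : -1 <= x -> (1 + x) ^+ n <= expR (n%:R * x).
Proof.
move=> x1; rewrite expRM_natl; apply: lerXn2r.
- by rewrite nnegrE; lra.
- by rewrite nnegrE expR_ge0.
- exact: expR_ge1Dx.
Qed.

Lemma natr_ex_ge (x : R) : exists n : nat, x <= n%:R.
Proof. by exists (Num.truncn x).+1; apply/ltW/truncnS_gt. Qed.

(** The tilt [expR x] depends on [p] and [q] only and gives decay [exp(- gam * d)] with [gam > 0],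
    which falls below any [z] as [d] grows. *)
Lemma tail_const (p q z : R) : 0 <= p -> p < q -> 0 < z ->
  exists2 l : R, 1 <= l & exists d0 : nat, forall d k : nat, (d0 <= d)%N ->
    q * d%:R <= k%:R -> (1 + p * (l - 1)) ^+ d / l ^+ k <= z.
Proof.
move=> p0 pq z0; have q0 : 0 < q by apply: le_lt_trans pq.
(* Chosen so that [q * (1 - x) = (p + q) / 2] exceeds [p]; together with [expR x - 1 <= x / (1 - x)]
   this makes [gam] positive. *)
pose x := (q - p) / (2 * q).
have x0 : 0 < x by rewrite divr_gt0 ?subr_gt0 ?mulr_gt0.
have x1 : x < 1 by rewrite /x ltr_pdivrMr ?mulr_gt0 //; lra.
have l1 : 1 <= expR x by apply: le_trans (expR_ge1Dx _); lra.
exists (expR x) => //.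
pose gam := x * q - p * (expR x - 1).
have gam0 : 0 < gam.
  have e1 : expR x - 1 <= x / (1 - x).
    have -> : x / (1 - x) = (1 - x)^-1 - 1 by field; lra.
    by rewrite lerD2r expR_le_inv.
  apply: (@lt_le_trans _ _ (x * q - p * (x / (1 - x)))); last first.
    by rewrite lerD2l lerN2 ler_wpM2l.
  have -> : x * q - p * (x / (1 - x)) = x * (q - p / (1 - x)) by field; lra.
  rewrite mulr_gt0 // subr_gt0 ltr_pdivrMr; last by rewrite subr_gt0.
  have -> : q * (1 - x) = (q + p) / 2 by rewrite /x; field; lra.
  lra.
(* A crude choice: the linear bound [1 + y <= expR y] at [y = d * gam >= 1 / z] is enough. *)
have [d0 d0P] := natr_ex_ge ((gam * z)^-1).
exists d0 => d k d0d qdk.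
have xk : expR (d%:R * (x * q)) <= expR x ^+ k.
  by rewrite -expRM_natl ler_expR; have := ler_wpM2r (ltW x0) qdk; lra.
have ed : (1 + p * (expR x - 1)) ^+ d <= expR (d%:R * (p * (expR x - 1))).
  apply: expr_1D_le_expR; apply: (@le_trans _ _ 0); first by lra.
  by rewrite mulr_ge0 // subr_ge0.
rewrite ler_pdivrMr ?exprn_gt0 ?expR_gt0 //.
apply: (le_trans ed); apply: (@le_trans _ _ (z * expR (d%:R * (x * q)))); last first.
  by rewrite ler_pM2l.
have -> : d%:R * (x * q) = d%:R * gam + d%:R * (p * (expR x - 1)).
  by rewrite /gam; ring.
rewrite expRD [z * _]mulrA -[leLHS]mul1r ler_pM2r ?expR_gt0 //.
rewrite -ler_pdivrMl // mulr1.
apply: le_trans (expR_ge1Dx _); apply: (@le_trans _ _ (d%:R * gam)); last by lra.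
rewrite -ler_pdivrMr // -invfM mulrC; apply: (le_trans d0P).
by rewrite ler_nat.
Qed.

Lemma expr_1D_le2 (p l : R) n :
  0 <= p -> 1 <= l -> n%:R * (p * l) <= 2^-1 -> (1 + p * (l - 1)) ^+ n <= 2.
Proof.
move=> p0 l1 h.
apply: (@le_trans _ _ (expR (n%:R * (p * (l - 1))))).
  apply: expr_1D_le_expR; apply: (@le_trans _ _ 0); first by lra.
  by rewrite mulr_ge0 // subr_ge0.
apply: (@le_trans _ _ (expR 2^-1)).
  rewrite ler_expR; apply: le_trans h; apply: ler_wpM2l => //.
  by apply: ler_wpM2l => //; lra.
exact: expR_half_le2.
Qed.

(** With [k] at least eight times the mean, [(1 + 3p)^n <= exp(3np) <= exp(k / 2) <= 2^k], and
    [2^k / 4^k] is the claimed bound. *)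
Lemma expr_1D_le2X (p : R) n k :
  0 <= p -> n%:R * p *+ 8 <= k%:R -> (1 + p * (4 - 1)) ^+ n / 4 ^+ k <= 2^-1 ^+ k.
Proof.
move=> p0 h; rewrite ler_pdivrMr ?exprn_gt0 // -exprMn.
have -> : 2^-1 * 4 = 2 :> R by lra.
apply: (@le_trans _ _ (expR (n%:R * (p * (4 - 1))))).
  by apply: expr_1D_le_expR; lra.
apply: (@le_trans _ _ (expR (k%:R * 2^-1))).
  rewrite ler_expR; move: h; rewrite -mulr_natr => h.
  have : 0 <= n%:R * p by rewrite mulr_ge0.
  lra.
rewrite expRM_natl; apply: lerXn2r; rewrite ?nnegrE ?expR_ge0 //.
exact: expR_half_le2.
Qed.

End Chernoff.

(** * Number of levels and decay of the zeros in one layer *)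

Definition depth (r0 r : nat) : nat := if r < r0 then 1 else trunc_log 2 r.

Lemma depth_gt0 r0 r : 1 < r -> 0 < depth r0 r.
Proof. by move=> r1; rewrite /depth; case: ifP => // _; rewrite trunc_log_gt0. Qed.

Lemma depth_le_log r0 r : 1 < r -> depth r0 r <= trunc_log 2 r.
Proof. by move=> r1; rewrite /depth; case: ifP => // _; rewrite trunc_log_gt0. Qed.

Lemma depth_lt r0 r : 1 < r -> depth r0 r < r.
Proof.
move=> r1; apply: leq_ltn_trans (depth_le_log r0 r1) _.
apply: leq_trans (ltn_expl _ (ltnSn 1)) _; apply: trunc_logP => //; lia.
Qed.

Lemma mul6_le_expn h : 5 <= h -> 6 * h <= 2 ^ h.
Proof.
elim: h => // h IH; rewrite leq_eqVlt => /orP [/eqP <- //|h5].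
rewrite expnS; have := IH h5; lia.
Qed.

Lemma large_depth a r : 2 ^ (a + 10) <= r ->
  let h := trunc_log 2 r in
  [/\ 2 ^ h <= r, r < 2 ^ h.+1, a + 10 <= h & 6 * h <= r].
Proof.
move=> ar h; have r0 : 0 < r by apply: leq_trans ar; rewrite expn_gt0.
have h1 : 2 ^ h <= r by exact: trunc_logP.
have h2 : r < 2 ^ h.+1 by exact: trunc_log_ltn.
have h3 : a + 10 <= h by apply: trunc_log_max.
by split => //; apply: leq_trans h1; apply: mul6_le_expn; lia.
Qed.

Section Layers.
Variable R : realType.
Local Open Scope ring_scope.

Lemma exp2V_le (m n : nat) : (n <= m)%N -> 2^-1 ^+ m <= 2^-1 ^+ n :> R.
Proof. by move=> nm; apply: ler_wiXn2l => //; lra. Qed.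

Lemma row_zero d t (S : pred nat) B u : (t <= d)%N ->
  (count S (gate_row d B u) < t)%N = (d.+1 - t <= count (predC S) (gate_row d B u))%N.
Proof.
move=> td; have := count_predC S (gate_row d B u); rewrite size_draws; lia.
Qed.

(** A gate gives 0 only if [v = d + 1 - t] of its inputs are zeros. Tilt [2 ^ e], the inverse of the
    zero rate, bounds this by [2 ^ d / 2 ^ (e * v)], and [e * v = 8e + e(v - 8) >= 8e + d + 3]. The
    factor 8 is what the last level of the cascade calls for. *)
Lemma row_zero_sparse d t B (S : pred nat) (a e : nat) :
  (t <= d)%N -> (8 <= d.+1 - t)%N -> (d + 3 <= a * (d.+1 - t - 8))%N -> (a <= e)%N ->
  (ones (predC S) (2 ^ B))%:R <= 2^-1 ^+ e * 2 ^+ B :> R ->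
  avg (d * B) (fun u => (count S (gate_row d B u) < t)%N%:R) <= 2^-1 ^+ (8 * e + 3) :> R.
Proof.
move=> td u8 ua ae Se.
rewrite (@eq_avg _ _ _ (fun u => (d.+1 - t <= count (predC S) (gate_row d B u))%N%:R)); last first.
  by move=> u _; rewrite row_zero.
have e1 : 1 <= 2 ^+ e :> R by apply: exprn_ege1; lra.
apply: (le_trans (row_tail d (d.+1 - t) e1 Se)).
have -> : 2^-1 ^+ e * (2 ^+ e - 1) = 1 - 2^-1 ^+ e :> R.
  by rewrite mulrBr -exprMn mulVf ?pnatr_eq0 ?expr1n ?mulr1.
apply: (@le_trans _ _ (2 ^+ d / 2 ^+ e ^+ (d.+1 - t))).
  rewrite ler_pM2r ?invr_gt0 ?exprn_gt0 //; apply: lerXn2r; rewrite ?nnegrE //.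
    have : 2^-1 ^+ e <= 1 :> R by apply: exprn_ile1; lra.
    lra.
  have : 0 <= 2^-1 ^+ e :> R by apply: exprn_ge0; lra.
  lra.
rewrite -exprM ler_pdivrMr ?exprn_gt0 //.
set v := (d.+1 - t)%N in ua u8 *.
have -> : (e * v = d + (8 * e + 3) + (e * v - (d + (8 * e + 3))))%N.
  rewrite subnKC //.
  have := leq_mul ae (leqnn (v - 8)%N); have -> : (e * v = e * 8 + e * (v - 8))%N.
    by rewrite -mulnDr subnKC.
  lia.
set m := (8 * e + 3)%N; rewrite [(d + m)%N]addnC -addnA exprD mulrA -exprMn.
rewrite mulVf ?pnatr_eq0 // expr1n mul1r exprD.
rewrite ler_peMr //; first exact: exprn_ge0.
by apply: exprn_ege1; lra.
Qed.

(** The summand 3 in the exponent keeps the mean number of zero gates at least eight times below the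
    threshold [2 ^ (B.-1 - j)], so the tail is exponentially small in the threshold itself. *)
Lemma layer_zero_few d t B (S : pred nat) (j r : nat) :
  avg (d * B) (fun u => (count S (gate_row d B u) < t)%N%:R) <= 2^-1 ^+ (j + 3) :> R ->
  (j <= B.-1)%N -> (2 * r <= 2 ^ (B.-1 - j))%N ->
  avg (layer_bits d B) (fun u => (2 ^ (B.-1 - j) <
        count (fun q => (count S q < t)%N) (layer d B u))%N%:R) <= 2^-1 ^+ (2 * r) :> R.
Proof.
move=> pS jB rB.
have l4 : 1 <= 4 :> R by lra.
apply: (le_trans (layer_tail (2 ^ (B.-1 - j)).+1 l4 pS)).
apply: (@le_trans _ _ (2^-1 ^+ (2 ^ (B.-1 - j)).+1)); last first.
  by apply: exp2V_le; apply: leqW.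
apply: expr_1D_le2X; first by apply: exprn_ge0; lra.
apply: (@le_trans _ _ ((2 ^ (B.-1 - j))%:R)); last by rewrite ler_nat.
rewrite !natrX -(subnKC jB) [in leLHS]exprD (addKn j) addnC exprD.
rewrite -mulr_natr.
have -> : 2 ^+ j * 2 ^+ (B.-1 - j) * (2^-1 ^+ 3 * 2^-1 ^+ j) * 8%:R =
   (2 ^+ j * 2^-1 ^+ j) * 2 ^+ (B.-1 - j) :> R by field.
by rewrite -exprMn mulfV ?pnatr_eq0 // expr1n mul1r.
Qed.

(** In essence a union bound over at most [2 ^ r.-1] gates, read off the tail bound with [k = 1] and
    tilt [2 ^ (r + 2)]. *)
Lemma layer_zero_none d t B (S : pred nat) r :
  avg (d * B) (fun u => (count S (gate_row d B u) < t)%N%:R) <= 2^-1 ^+ (2 * r + 2) :> R ->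
  (B <= r)%N -> (0 < r)%N ->
  avg (layer_bits d B) (fun u => (0 <
        count (fun q => (count S q < t)%N) (layer d B u))%N%:R) <= 2^-1 ^+ r.+1 :> R.
Proof.
move=> pS Br r0.
have l1 : 1 <= 2 ^+ (r + 2) :> R by apply: exprn_ege1; lra.
apply: (le_trans (layer_tail 1 l1 pS)).
rewrite expr1 ler_pdivrMr ?exprn_gt0 //.
have -> : 2^-1 ^+ r.+1 * 2 ^+ (r + 2) = 2 :> R.
  by rewrite addn2 [2 ^+ r.+2]exprSr mulrA -exprMn mulVf ?pnatr_eq0 // expr1n mul1r.
apply: expr_1D_le2 => //; first by apply: exprn_ge0; lra.
rewrite natrX.
apply: (@le_trans _ _ (2 ^+ r.-1 * (2^-1 ^+ (2 * r + 2) * 2 ^+ (r + 2)))).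
  apply: ler_wpM2r.
    by rewrite mulr_ge0 // exprn_ge0 //; lra.
  by apply: ler_weXn2l; [lra | lia].
have -> : (2 * r + 2 = r.-1 + (r + 2) + 1)%N by lia.
rewrite !exprD expr1.
have -> : 2 ^+ r.-1 * (2^-1 ^+ r.-1 * (2^-1 ^+ r * 2^-1 ^+ 2) / 2 * (2 ^+ r * 2 ^+ 2)) =
   (2 ^+ r.-1 * 2^-1 ^+ r.-1) * (2 ^+ r * 2^-1 ^+ r) / 2 :> R by field.
by rewrite -!exprMn mulfV ?pnatr_eq0 // !expr1n; lra.
Qed.

End Layers.

Lemma ones_predC S n : ones S n + ones (predC S) n = n.
Proof.
rewrite /ones -big_split /= (eq_bigr (fun=> 1)); last by move=> i _; case: (S i).
by rewrite sum_nat_const card_ord muln1.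
Qed.

Lemma layer_bits_le d B r : B <= r -> layer_bits d B <= d * r * 2 ^ r.
Proof.
move=> Br; rewrite /layer_bits mulnC leq_mul ?leq_mul ?leq_exp2l //; lia.
Qed.

(** * Completeness of the cascade *)

Section Completeness.
Variable R : realType.
Local Open Scope ring_scope.

(** The exponent assumed for the first level adds up two demands: [a + 5 = (a + 2) + 3] starts the
    cascade at zero rate [2 ^ - (a + 2)] when [r >= r0], and [2 * r0 + 2] leaves no zero at once
    when [r < r0] and there is only one level. *)
Lemma level_complete (d t a : nat) (c : R) :
  let r0 := (2 ^ (a + 10))%N in
  (t <= d)%N -> (8 <= d.+1 - t)%N -> (d + 3 <= a * (d.+1 - t - 8))%N ->
  (forall B (S : pred nat), (ones (predC S) (2 ^ B))%:R <= (1 - c) * 2 ^+ B ->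
     avg (d * B) (fun u => (count S (gate_row d B u) < t)%N%:R)
       <= 2^-1 ^+ (a + 5 + (2 * r0 + 2)) :> R) ->
  forall r S n, let h := depth r0 r in
  (1 < r)%N -> c * 2 ^+ r <= (ones S (2 ^ r))%:R ->
  (\sum_(j < h) layer_bits d (r - j) <= n)%N ->
  avg n (fun w => (0 < ones (predC (level d t r S w h)) (2 ^ (r - h)))%N%:R)
    <= 2^-1 ^+ r :> R.
Proof.
move=> r0 td u8 ua rowS r S n h r1 Sc hn.
have h0 : (0 < h)%N := depth_gt0 r0 r1.
have hr : (h < r)%N := depth_lt r0 r1.
have Sz : (ones (predC S) (2 ^ r))%:R <= (1 - c) * 2 ^+ r :> R.
  have := ones_predC S (2 ^ r); move/(congr1 (fun x => x%:R : R)).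
  rewrite natrD natrX; lra.
(* Either alternative means at least two levels, hence [r >= r0] and the estimates for large [r]. *)
have big l : (l < h)%N -> (0 < l)%N || (1 < h)%N ->
    [/\ (2 * 2 ^ l <= r)%N, (r < 2 * 2 ^ h)%N, (a + 10 <= h)%N & (6 * h <= r)%N].
  move=> lh l0; have r0r : (r0 <= r)%N.
    rewrite leqNgt; apply/negP => rr0; move: lh l0.
    by rewrite /h /depth rr0; case: l.
  have hE : h = trunc_log 2 r by rewrite /h /depth ltnNge r0r.
  have [h1 h2 h3 h4] := large_depth r0r.
  rewrite hE in lh *; split => //; last by rewrite -expnS.
  by apply: leq_trans h1; rewrite -expnS leq_exp2l.
(* A fraction 2^-(a + 2^l) of zeros is allowed at level l. *)
pose E l := if l == h then 0%N else
  if l is l'.+1 then (2 ^ (r - l'.+1 - (a + 2 ^ l'.+1)))%N else ones (predC S) (2 ^ r).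
(* The last level may use half of the error [2 ^ - r]; the others, fewer than [2 ^ r.-1] in number,
   share the other half. *)
pose b l : R := if l.+1 == h then 2^-1 ^+ r.+1 else 2^-1 ^+ (2 * r).
suff : avg n (fun w => (E h < ones (predC (level d t r S w h)) (2 ^ (r - h)))%N%:R)
    <= 2^-1 ^+ r :> R by rewrite {1}/E eqxx.
have E0 : E 0%N = ones (predC S) (2 ^ r) by rewrite /E eq_sym gtn_eqF.
(* As [2 ^ l <= r / 2], [3h <= r / 2], [l < h] and [a + 10 <= h], the exponent [r - l - a - 2 ^ l]
   is at least [h + 2], and [2r < 2 ^ (h + 2)]. *)
have exp_small l : (0 < l)%N -> (l < h)%N ->
    (2 * r <= 2 ^ (r - l - (a + 2 ^ l)))%N /\ (a + 2 ^ l <= r - l)%N.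
  move=> l0 lh; have [h1 h2 h3 h4] := big l lh (introT orP (or_introl l0)).
  split; last by lia.
  apply: (@leq_trans (2 ^ (h + 2))); first by rewrite expnD; lia.
  by rewrite leq_exp2l //; lia.
apply: (@le_trans _ _ (\sum_(l < h) b l)).
  apply: level_fail => //; last 2 first.
  - by rewrite E0.
  - exact: ltnW.
  move=> [|l] S' lh Sl.
    rewrite E0 subn0 in Sl; rewrite subn0.
    have pr : avg (d * r) (fun u => (count S' (gate_row d r u) < t)%N%:R)
       <= 2^-1 ^+ (a + 5 + (2 * r0 + 2)) :> R.
      by apply: rowS; apply: le_trans Sz; rewrite ler_nat.
    rewrite /E /b; case: ifPn => [h1|h1].
      apply: layer_zero_none => //; last by lia.
      apply: (le_trans pr); apply: exp2V_le.
      have : (r < r0)%N; last by lia.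
      rewrite ltnNge; apply/negP => r0r.
      have hE : h = trunc_log 2 r by rewrite /h /depth ltnNge r0r.
      have [_ _ + _] := large_depth r0r; rewrite -hE -(eqP h1); lia.
    have h1' : (1 < h)%N by rewrite ltn_neqAle h1.
    have [e1 e2] := exp_small 1%N isT h1'.
    rewrite subn1 in e1 e2 *.
    apply: layer_zero_few => //.
    apply: (le_trans pr); apply: exp2V_le; lia.
  have rl : (ones (predC S') (2 ^ (r - l.+1)))%:R <=
       2^-1 ^+ (a + 2 ^ l.+1) * 2 ^+ (r - l.+1) :> R.
    have [e1 e2] := exp_small l.+1 isT lh.
    have El : E l.+1 = (2 ^ (r - l.+1 - (a + 2 ^ l.+1)))%N by rewrite /E ltn_eqF.
    rewrite El in Sl.
    apply: (@le_trans _ _ ((2 ^ (r - l.+1 - (a + 2 ^ l.+1)))%:R)); first by rewrite ler_nat.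
    have -> : 2 ^+ (r - l.+1) = 2 ^+ (a + 2 ^ l.+1) * 2 ^+ (r - l.+1 - (a + 2 ^ l.+1)) :> R.
      by rewrite -exprD subnKC.
    rewrite natrX mulrA -exprMn mulVf ?pnatr_eq0 //.
    by rewrite expr1n mul1r.
  have pr := row_zero_sparse td u8 ua (leq_addr _ _) rl.
  have [h1 h2 h3 h4] := big l.+1 lh isT.
  rewrite /E /b; case: ifPn => [/eqP lE|lE].
    (* With [l.+2 = h], the term [8 * 2 ^ l.+1] equals [2 * 2 ^ h.+1], which is at least
       [2 * r + 2]. *)
    apply: layer_zero_none; [|lia|lia].
    apply: (le_trans pr); apply: exp2V_le.
    by rewrite -lE !expnS in h2 *; lia.
  have lh' : (l.+2 < h)%N by rewrite ltn_neqAle lE.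
  have [e1 e2] := exp_small l.+2 isT lh'.
  have rE : (r - l.+2 = (r - l.+1).-1)%N by lia.
  rewrite rE in e1 e2 *.
  apply: layer_zero_few => //.
  apply: (le_trans pr); apply: exp2V_le.
  rewrite !expnS; lia.
have [h' hE] : exists h', h = h'.+1 by exists h.-1; lia.
rewrite hE big_ord_recr /= {2}/b hE eqxx.
have -> : 2^-1 ^+ r = 2^-1 ^+ r.+1 + 2^-1 ^+ r.+1 :> R.
  by rewrite exprS; set x := _ ^+ r; lra.
rewrite lerD2r.
apply: (@le_trans _ _ (\sum_(i < h') 2^-1 ^+ (2 * r))).
  by apply: ler_sum => i _; rewrite /b hE eqSS ltn_eqF.
rewrite sumr_const card_ord -[_ *+ h']mulr_natl.
have -> : 2^-1 ^+ (2 * r) = 2^-1 ^+ r.+1 * 2^-1 ^+ r.-1 :> R.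
  by rewrite -exprD; congr (_ ^+ _); lia.
rewrite mulrCA -[leRHS]mulr1 ler_wpM2l ?exprn_ge0 //; first by lra.
rewrite exprVn ler_pdivrMr ?exprn_gt0 // mul1r -natrX ler_nat.
by apply: leq_trans (ltnW (ltn_expl _ (ltnSn 1))); lia.
Qed.

End Completeness.

Lemma gate_row_lt d B u : all (fun v => v < 2 ^ B) (gate_row d B u).
Proof. by rewrite /gate_row; elim: d u => //= d IH u; rewrite num_lt IH. Qed.

Lemma layer_lt d B u : all (all (fun v => v < 2 ^ B)) (layer d B u).
Proof.
by rewrite /layer; elim: (2 ^ B.-1) u => //= n IH u; rewrite gate_row_lt IH.
Qed.

(** * Sampling property of a random wiring, and choice of the constants *)

Section Soundness.
Variable R : realType.
Local Open Scope ring_scope.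

(** A one-sided sampler; [S] is universally quantified because the prover chooses the levels with
    the wiring in view. *)
Definition sampling (p s : R) (t B : nat) (L : seq (seq nat)) : Prop :=
  forall S : pred nat, (ones S (2 ^ B))%:R <= p * 2 ^+ B ->
    (count (fun q => (t <= count S q)%N) L)%:R <= s * 2 ^+ B.-1.

(** For a fixed set more than [s * N] of the [N] gates have to err, which has probability at most
    [2^N * 2^(- (3 + rho) N)], the factor [2^N] coming from the tilt [2 ^ b]. Multiplying by the
    [2^(2N)] sets leaves [2^(- rho N)]. *)
Lemma layer_sampling (d t B b rho : nat) (p s : R) :
  (0 < B)%N -> 0 < s -> (3 + rho)%:R <= b%:R * s ->
  (forall S : pred nat, (ones S (2 ^ B))%:R <= p * 2 ^+ B ->
     avg (d * B) (fun u => (t <= count S (gate_row d B u))%N%:R) <= 2^-1 ^+ b :> R) ->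
  avg (layer_bits d B) (fun u => (`[< ~ sampling p s t B (layer d B u) >])%:R)
    <= 2^-1 ^+ (rho * 2 ^ B.-1) :> R.
Proof.
move=> B0 s0 bs rowS; set N := (2 ^ B.-1)%N.
have BN : (2 ^ B = 2 * N)%N by rewrite /N -expnS prednK.
pose Q (T : (2 ^ B).-tuple bool) u :=
  ((ones (nth false T) (2 ^ B))%:R <= p * 2 ^+ B) &&
  (s * 2 ^+ B.-1 < (count (fun q => (t <= count (nth false T) q)%N) (layer d B u))%:R).
apply: (@le_trans _ _ (avg (layer_bits d B) (fun u =>
    \sum_(T : (2 ^ B).-tuple bool) (Q T u)%:R))).
  apply: avg_le => u _; case: asboolP => [nS|_]; last first.
    by apply: sumr_ge0 => *; rewrite ler0n.
  have [S S1 S2] : exists2 S : pred nat, (ones S (2 ^ B))%:R <= p * 2 ^+ B &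
     ~ (count (fun q => (t <= count S q)%N) (layer d B u))%:R <= s * 2 ^+ B.-1.
    by move/existsNP: nS => [S /not_implyP [S1 S2]]; exists S.
  (* All inputs of the layer lie below [2 ^ B], so a set matters only through its first [2 ^ B]
     bits; this makes the union finite. *)
  pose T := [tuple of mkseq S (2 ^ B)].
  have TS v : (v < 2 ^ B)%N -> nth false T v = S v.
    by move=> vB; rewrite /T /= nth_mkseq.
  have QT : Q T u.
    rewrite /Q; apply/andP; split.
      suff -> : ones (nth false T) (2 ^ B) = ones S (2 ^ B) by [].
      by apply: eq_bigr => v _; rewrite TS.
    move/negP: S2; rewrite -ltNge; congr (_ < _%:R).
    apply: eq_in_count => q qL; congr (_ <= _)%N; apply: eq_in_count => v vq.
    by rewrite TS //; move/allP: (layer_lt d B u) => /(_ _ qL)/allP/(_ _ vq).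
  by rewrite (bigD1 T) //= QT lerDl; apply: sumr_ge0 => *; rewrite ler0n.
rewrite avg_sum.
apply: (@le_trans _ _ (\sum_(T : (2 ^ B).-tuple bool) 2^-1 ^+ ((2 + rho) * N))).
  apply: ler_sum => T _; rewrite /Q.
  case: (boolP (_ <= p * _)) => [pT|_] /=; last first.
    by rewrite avg_const exprn_ge0 //; lra.
  set k := (Num.truncn (s * 2 ^+ B.-1)).+1.
  have l1 : 1 <= 2 ^+ b :> R by apply: exprn_ege1; lra.
  have := @layer_tail _ d B (fun q => t <= count (nth false T) q)%N _ _ k l1 (rowS _ pT).
  have -> : 2^-1 ^+ b * (2 ^+ b - 1) = 1 - 2^-1 ^+ b :> R.
    by rewrite mulrBr -exprMn mulVf ?pnatr_eq0 ?expr1n ?mulr1.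
  move=> lt; apply: le_trans (le_trans lt _).
    apply: avg_le => u _; rewrite ler_nat.
    case: ltP => //= sN; rewrite lt0b /k truncn_lt_nat //.
    by apply: mulr_ge0; rewrite ?exprn_ge0 // ltW.
  rewrite -/N.
  have b01 : 0 <= (2^-1 : R) ^+ b <= 1.
    by apply/andP; split; [apply: exprn_ge0 | apply: exprn_ile1]; lra.
  apply: (@le_trans _ _ (2 ^+ N / 2 ^+ b ^+ k)).
    rewrite ler_pM2r ?invr_gt0 ?exprn_gt0 //; apply: lerXn2r; rewrite ?nnegrE //; lra.
  have kN : ((3 + rho) * N <= b * k)%N.
    rewrite -(ler_nat R) !natrM.
    apply: (@le_trans _ _ (b%:R * s * N%:R)); first by rewrite ler_wpM2r.
    rewrite -mulrA ler_wpM2l // /N natrX ltW //.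
    by rewrite /k truncnS_gt.
  rewrite -exprM -exprVn.
  apply: (@le_trans _ _ (2 ^+ N * 2^-1 ^+ (N + (2 + rho) * N))).
    by rewrite ler_pM2l ?exprn_gt0 //; apply: exp2V_le; lia.
  by rewrite exprD mulrA -exprMn mulfV ?pnatr_eq0 // expr1n mul1r.
rewrite sumr_const card_tuple card_bool BN -[_ *+ (2 ^ _)]mulr_natl natrX.
have -> : 2^-1 ^+ ((2 + rho) * N) = 2^-1 ^+ (2 * N) * 2^-1 ^+ (rho * N) :> R.
  by rewrite -exprD mulnDl.
by rewrite mulrA -exprMn mulfV ?pnatr_eq0 // expr1n mul1r.
Qed.

(** The topmost layer has the fewest gates, but for [r >= r0] still at least [2 ^ (h + 2) > 2r], so
    every layer fails with probability at most [2^(-2r)]. With a single layer, [r < r0], the factor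
    [r0] in the exponent alone gives [2^(-r)]. *)
Lemma wiring_sampling (d t a b : nat) (p s : R) :
  let r0 := (2 ^ (a + 10))%N in
  0 < s -> (3 + r0)%:R <= b%:R * s ->
  (forall B (S : pred nat), (ones S (2 ^ B))%:R <= p * 2 ^+ B ->
     avg (d * B) (fun u => (t <= count S (gate_row d B u))%N%:R) <= 2^-1 ^+ b :> R) ->
  forall r n, let h := depth r0 r in
  (1 < r)%N -> (\sum_(j < h) layer_bits d (r - j) <= n)%N ->
  avg n (fun w => (`[< exists2 k, (k < h)%N &
                     ~ sampling p s t (r - k) (wiring d r w k) >])%:R)
    <= 2^-1 ^+ r :> R.
Proof.
move=> r0 s0 bs rowS r n h r1 hn.
have hr : (h < r)%N := depth_lt r0 r1.
pose bad k (w : seq bool) := `[< ~ sampling p s t (r - k) (wiring d r w k) >].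
apply: (@le_trans _ _ (avg n (fun w => \sum_(k < h) (bad k w)%:R))).
  apply: avg_le => w _; case: asboolP => [[k kh bk]|_]; last first.
    by apply: sumr_ge0 => *; rewrite ler0n.
  rewrite (bigD1 (Ordinal kh)) //= /bad; case: asboolP => // _.
  by rewrite lerDl; apply: sumr_ge0 => *; rewrite ler0n.
rewrite avg_sum.
have step k : (k < h)%N -> avg n (fun w => (bad k w)%:R) <= 2^-1 ^+ (r0 * 2 ^ (r - k).-1) :> R.
  move=> kh; set sk := (\sum_(j < k) layer_bits d (r - j))%N.
  have skn : (sk + layer_bits d (r - k) <= n)%N.
    apply: leq_trans hn; rewrite -(subnKC kh) big_split_ord /= big_ord_recr /=.
    exact: leq_addr.
  pose F u : R := (`[< ~ sampling p s t (r - k) (layer d (r - k) u) >])%:R.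
  have -> : avg n (fun w => (bad k w)%:R) = avg n (fun w => F (drop sk w)).
    by apply: eq_avg => w _; rewrite /F /bad /wiring tape_at_drop.
  rewrite avg_drop; last by apply: leq_trans skn; apply: leq_addr.
  rewrite (@avg_reads _ (layer_bits d (r - k))).
  - by apply: (@layer_sampling _ _ _ b) => //; [lia | exact: rowS].
  - by rewrite leq_subRL //; apply: leq_trans skn; apply: leq_addr.
  - move=> u v su; rewrite /F.
    by rewrite (reads_layer v su).
apply: (@le_trans _ _ (\sum_(k < h) 2^-1 ^+ (r0 * 2 ^ (r - k).-1))).
  by apply: ler_sum => k _; apply: step.
have [rr0|r0r] := ltnP r r0.
  have -> : h = 1%N by rewrite /h /depth rr0.
  rewrite big_ord1 subn0; apply: exp2V_le; apply: (leq_trans (ltnW rr0)).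
  by rewrite leq_pmulr // expn_gt0.
have hE : h = trunc_log 2 r by rewrite /h /depth ltnNge r0r.
have [h1 h2 h3 h4] := large_depth r0r; rewrite -hE in h1 h2 h3 h4.
apply: (@le_trans _ _ (\sum_(k < h) 2^-1 ^+ (2 * r))).
  apply: ler_sum => k _; apply: exp2V_le.
  apply: (@leq_trans (2 ^ (h + 2))); first by rewrite addn2 expnS; lia.
  apply: (@leq_trans (2 ^ (r - k).-1)); last by rewrite leq_pmull // expn_gt0.
  rewrite leq_exp2l //; have := ltn_ord k; lia.
rewrite sumr_const card_ord -[_ *+ h]mulr_natl mul2n -addnn exprD mulrA.
rewrite -[leRHS]mul1r ler_wpM2r ?exprn_ge0 //; first by lra.
rewrite exprVn ler_pdivrMr ?exprn_gt0 // mul1r -natrX ler_nat.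
by apply: leq_trans (ltnW (ltn_expl _ (ltnSn 1))); lia.
Qed.

(** The choice is not circular: [a] depends on the gap, [r0] on [a], [b] on [r0] and [s], and [d]
    comes last. The same threshold separates ones at rate [p < tau] from zeros at rate [1 - c < be],
    where [be = 1 - tau]. *)
Lemma parameters (c s : R) : 0 < c < 1 -> 0 < s < 1 -> s < c ->
  exists r0 d t : nat, let p := s + (c - s) / 4 in
  (forall r S n, let h := depth r0 r in
     (1 < r)%N -> c * 2 ^+ r <= (ones S (2 ^ r))%:R ->
     (\sum_(j < h) layer_bits d (r - j) <= n)%N ->
     avg n (fun w => (0 < ones (predC (level d t r S w h)) (2 ^ (r - h)))%N%:R)
       <= 2^-1 ^+ r :> R) /\
  (forall r n, let h := depth r0 r in
     (1 < r)%N -> (\sum_(j < h) layer_bits d (r - j) <= n)%N ->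
     avg n (fun w => (`[< exists2 k, (k < h)%N &
                        ~ sampling p s t (r - k) (wiring d r w k) >])%:R)
       <= 2^-1 ^+ r :> R).
Proof.
move=> /andP [c0 c1] /andP [s0 s1] sc.
pose tau := (c + s) / 2; pose be := 1 - tau.
have be0 : 0 < be by rewrite /be /tau; lra.
(* Below, [v = d + 1 - t] is at least [be * d >= 16], so [v - 8 >= be * d / 2] and
   [a * (v - 8) >= 2 * d >= d + 3]. *)
have [a aP] := natr_ex_ge (4 / be).
have [r0 r0E] : exists r0, r0 = (2 ^ (a + 10))%N by eexists.
pose p := s + (c - s) / 4.
have [b bP] := natr_ex_ge ((3 + r0)%:R / s).
have half n : 0 < 2^-1 ^+ n :> R by rewrite exprn_gt0; lra.
have p0 : 0 <= p by rewrite /p; lra.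
have ptau : p < tau by rewrite /p /tau; lra.
have c10 : 0 <= 1 - c by lra.
have cbe : 1 - c < be by rewrite /be /tau; lra.
have [l1 l1P [d1 d1P]] := tail_const p0 ptau (half b).
have [l2 l2P [d2 d2P]] := tail_const c10 cbe (half (a + 5 + (2 * r0 + 2))%N).
have [d3 d3P] := natr_ex_ge (16 / be).
have [d dE] : exists d, d = (d1 + d2 + d3 + 3)%N by eexists.
(* Rounding up serves both sides: [t >= tau * d], and still [d + 1 - t >= be * d]. *)
have [t tE] : exists t, t = (Num.truncn (tau * d%:R)).+1 by eexists.
have d3d : (d3%:R : R) <= d%:R by rewrite ler_nat; clear -dE; lia.
have tau0 : 0 <= tau by rewrite /tau; lra.
have /andP [t1 t2] := truncn_itv (mulr_ge0 tau0 (ler0n R d)).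
have td1 : tau * d%:R <= t%:R by rewrite tE; exact: ltW.
have td2 : t%:R <= tau * d%:R + 1 by rewrite tE -natr1; lra.
have bd : 16 <= be * d%:R.
  by rewrite mulrC -ler_pdivrMr //; apply: le_trans d3d.
have td : (t <= d)%N by rewrite -(ler_nat R); move: bd; rewrite /be; lra.
have ud : be * d%:R <= (d.+1 - t)%:R.
  by rewrite natrB ?(leqW td) // -natr1 /be; lra.
have u16 : (16 <= d.+1 - t)%N by rewrite -(ler_nat R); apply: le_trans ud.
exists r0, d, t; split.
  rewrite r0E; apply: level_complete => //.
  - exact: leq_trans u16.
  - have au : 2 * d%:R <= (a * (d.+1 - t - 8))%:R :> R.
      rewrite natrM natrB; last by apply: leq_trans u16.
      apply: (@le_trans _ _ (a%:R * (be * d%:R / 2))); last first.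
        by rewrite ler_wpM2l //; lra.
      have : 4 <= a%:R * be by rewrite -ler_pdivrMr.
      have : 0 <= d%:R :> R by [].
      set x : R := d%:R; set y : R := a%:R => x0 yb.
      have := ler_wpM2r x0 yb; lra.
    rewrite -natrM ler_nat in au; apply: leq_trans au; clear -dE; lia.
  - move=> B S SB.
    rewrite (@eq_avg _ _ _ (fun u => (d.+1 - t <= count (predC S) (gate_row d B u))%N%:R)); last first.
      by move=> u _; rewrite row_zero.
    apply: (le_trans (row_tail d (d.+1 - t) l2P SB)).
    by rewrite -r0E; apply: d2P => //; clear -dE; lia.
rewrite r0E; apply: (@wiring_sampling _ _ a b) => //.
  by rewrite -r0E -ler_pdivrMr.
move=> B S SB; apply: (le_trans (row_tail d t l1P SB)).
by apply: d1P => //; clear -dE; lia.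
Qed.

End Soundness.

(** * Circuits *)

Definition shift_gate (i j : nat) (g : gate) : gate :=
  match g with
  | GInput x => GInput (i + x)
  | GNand x y => GNand (j + x) (j + y)
  end.

Definition wires (a ws : seq bool) (C : seq gate) : seq bool :=
  foldl (fun w g => rcons w (gate_val a w g)) ws C.

Arguments wires : simpl never.

Lemma wires_cons a ws g C :
  wires a ws (g :: C) = wires a (rcons ws (gate_val a ws g)) C.
Proof. by []. Qed.

Lemma size_wires a ws C : size (wires a ws C) = size ws + size C.
Proof.
elim: C ws => [|g C IH] ws; first by rewrite addn0.
by rewrite wires_cons IH size_rcons addSnnS.
Qed.

Lemma wires_cat a ws C1 C2 : wires a ws (C1 ++ C2) = wires a (wires a ws C1) C2.
Proof. exact: foldl_cat. Qed.

(** Relocation: the shifted circuit sees neither the earlier wires nor the first [i] answers.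
    References out of range agree as well, since both sides read [false]. *)
Lemma wires_shift a ws loc C i :
  wires a (ws ++ loc) (map (shift_gate i (size ws)) C) =
  ws ++ wires (drop i a) loc C.
Proof.
elim: C loc => [|g C IH] loc //.
rewrite map_cons !wires_cons -IH -rcons_cat; congr (wires a (rcons _ _) _).
have nthS x : nth false (ws ++ loc) (size ws + x) = nth false loc x.
  by rewrite nth_cat ltnNge leq_addr /= addKn.
by case: g => [x|x y] /=; rewrite ?nthS // nth_drop.
Qed.

Lemma nth_wires a ws C j : j < size ws -> nth false (wires a ws C) j = nth false ws j.
Proof.
elim: C ws => [|g C IH] ws // jw; rewrite wires_cons IH ?size_rcons ?leqW //.
by rewrite nth_rcons jw.
Qed.

Definition nand_circuit (C1 C2 : seq gate) : seq gate :=
  C1 ++ map (shift_gate 0 (size C1)) C2 ++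
  [:: GNand (size C1).-1 (size C1 + size C2).-1].

Lemma circuit_evalE a C : circuit_eval a C = nth false (wires a [::] C) (size C).-1.
Proof. by rewrite /circuit_eval -/(wires a [::] C) -nth_last size_wires. Qed.

Lemma nand_circuitE a C1 C2 : 0 < size C1 -> 0 < size C2 ->
  circuit_eval a (nand_circuit C1 C2) = ~~ (circuit_eval a C1 && circuit_eval a C2).
Proof.
move=> s1 s2; rewrite !circuit_evalE /nand_circuit !size_cat size_map /= !wires_cat.
set W := wires a [::] C1.
have sW : size W = size C1 by rewrite size_wires.
have -> : wires a W (map (shift_gate 0 (size C1)) C2) = W ++ wires a [::] C2.
  by have := wires_shift a W [::] C2 0; rewrite cats0 drop0 sW.
rewrite wires_cons /= nth_rcons size_cat size_wires sW /= add0n.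
have -> : (size C1 + (size C2 + 1)).-1 = size C1 + size C2 by lia.
rewrite ltnn eqxx !nth_cat sW prednK // leqnn.
have -> : (size C1 + size C2).-1 < size C1 = false by lia.
by have -> : (size C1 + size C2).-1 - size C1 = (size C2).-1 by lia.
Qed.

(** Shannon expansion on the last answer. The exponential size is harmless, as [k] will be the
    constant [d.+1]. *)
Lemma circuit_exists (k : nat) (phi : seq bool -> bool) :
  exists2 C, 0 < size C & forall a, circuit_eval a C = phi (mkseq (nth false a) k).
Proof.
have nandP C1 C2 : 0 < size (nand_circuit C1 C2) by rewrite !size_cat /= addnA addn1.
elim: k phi => [|k IH] phi.
  case E: (phi [::]).
    (* A first gate [GNand 0 0] reads a missing wire as [false] and is the constant true; a second
       one negates it. *)
    by exists [:: GNand 0 0] => // a; rewrite /mkseq /= E.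
  by exists [:: GNand 0 0; GNand 0 0] => // a; rewrite /mkseq /= E.
have [C1 s1 E1] := IH (fun s => phi (rcons s true)).
have [C0 s0 E0] := IH (fun s => phi (rcons s false)).
pose X := [:: GInput k]; pose NX := nand_circuit X X.
exists (nand_circuit (nand_circuit X C1) (nand_circuit NX C0)) => // a.
rewrite !nand_circuitE // E1 E0 mkseqS.
have -> : circuit_eval a X = nth false a k by [].
by case: (nth false a k); rewrite /= ?andbT negbK.
Qed.

(* Local wire 0 of a link is the conjunction of the checks made so far; the
   last wire of the link is that conjunction extended by [C]. *)
Definition link (C : seq gate) : seq gate :=
  map (shift_gate 0 1) C ++
  [:: GNand 0 (size C); GNand (size C).+1 (size C).+1].

Lemma size_link C : size (link C) = size C + 2.
Proof. by rewrite size_cat size_map. Qed.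

Lemma link_wires a acc C : 0 < size C ->
  nth false (wires a [:: acc] (link C)) (size (link C)) = acc && circuit_eval a C.
Proof.
move=> sC; rewrite size_link /link wires_cat circuit_evalE.
have -> : wires a [:: acc] (map (shift_gate 0 1) C) = acc :: wires a [::] C.
  by have := wires_shift a [:: acc] [::] C 0; rewrite drop0.
set W := wires a [::] C; have sW : size W = size C by rewrite size_wires.
have VE : nth false (acc :: W) (size C) = nth false W (size C).-1 by case: (size C) sC.
have V0 : nth false (acc :: W) 0 = acc by [].
have sV : size (acc :: W) = (size C).+1 by rewrite /= sW.
move: (acc :: W) VE V0 sV => V VE V0 sV.
have g1 x : nth false (rcons V x) (size C).+1 = x by rewrite nth_rcons sV ltnn eqxx.
have g2 x y : nth false (rcons (rcons V x) y) (size C + 2) = y.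
  by rewrite nth_rcons size_rcons sV addn2 ltnn eqxx.
rewrite !wires_cons [wires _ _ [::]]/wires /= g2 g1 VE V0.
by rewrite andbb negbK.
Qed.

(** The opening gate is the constant true, i.e. the empty conjunction. Copy [k] is shifted by
    [k * size L], so its local wire 0 coincides with the last wire before it and the accumulator is
    threaded through. *)
Definition chain (m h : nat) (L : seq gate) : seq gate :=
  GNand 0 0 ::
  flatten [seq map (shift_gate (1 + k * m) (k * size L)) L | k <- iota 0 h].

Lemma size_chain m h L : size (chain m h L) = (h * size L).+1.
Proof.
rewrite /= size_flatten /shape -map_comp; congr _.+1.
rewrite (eq_map (g := fun=> size L)); last by move=> k; rewrite /= size_map.
by elim: h 0 => //= h IH j; rewrite IH mulSn.
Qed.

Lemma chainS m h L :
  chain m h.+1 L = chain m h L ++ map (shift_gate (1 + h * m) (h * size L)) L.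
Proof.
rewrite /chain -[h.+1]addn1 iotaD map_cat flatten_cat /= add0n cats0 //.
Qed.

Lemma chain_wires a m h C : 0 < size C ->
  let W := wires a [::] (chain m h (link C)) in
  nth false W 0 = true /\
  nth false W (h * size (link C)) =
    all (fun k => circuit_eval (drop (1 + k * m) a) C) (iota 0 h).
Proof.
move=> sC /=; elim: h => [|h [IH0 IH]]; first by [].
rewrite chainS wires_cat.
set W := wires a [::] (chain m h (link C)) in IH0 IH *.
have sW : size W = (h * size (link C)).+1 by rewrite size_wires size_chain.
split; first by rewrite nth_wires // sW.
have [ws [acc WE]] : exists ws acc, W = rcons ws acc.
  by case/lastP: W sW {IH0 IH} => // ws acc _; exists ws, acc.
have sws : size ws = h * size (link C) by move: sW; rewrite WE size_rcons => -[].
have accE : nth false W (h * size (link C)) = acc.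
  by rewrite WE nth_rcons -sws ltnn eqxx.
rewrite -[h.+1]addn1 iotaD all_cat /= andbT add0n -IH accE.
rewrite WE -cats1 -sws wires_shift nth_cat.
rewrite mulnDl mul1n -sws ltnNge leq_addr /= addKn.
exact: link_wires.
Qed.

(** Wire [u + 2] is the implication from the claimed verdict to the old verdict on wire [u.-1]; the
    later gates conjoin it with answer [zh] and with [acc]. *)
Definition closing (u acc zh : nat) : seq gate :=
  [:: GInput 0; GNand u.-1 u.-1; GNand u (u + 1); GInput zh;
      GNand (u + 2) (u + 3); GNand (u + 4) (u + 4);
      GNand (u + 5) acc; GNand (u + 6) (u + 6)].

Lemma closing_wires a U acc zh : acc < size U ->
  last false (wires a U (closing (size U) acc zh)) =
  [&& nth false a 0 ==> nth false U (size U).-1, nth false a zh & nth false U acc].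
Proof.
move=> aU; have U0 : (size U).-1 < size U by lia.
have nU L x : x < size U -> nth false (U ++ L) x = nth false U x.
  by move=> xU; rewrite nth_cat xU.
have nL L x : nth false (U ++ L) (size U + x) = nth false L x.
  by rewrite nth_cat ltnNge leq_addr /= addKn.
have nL0 L : nth false (U ++ L) (size U) = nth false L 0 by rewrite -[RHS]nL addn0.
rewrite -[U in wires _ U _]cats0 /closing !wires_cons.
rewrite [wires _ _ [::]]/wires !rcons_cat last_cat /= !(nL, nL0, nU _ _ U0, nU _ _ aU) /=.
by case: (nth _ a 0); case: (nth _ U (size U).-1); case: (nth _ a zh); case: (nth _ U acc).
Qed.

(* The answers to the extra queries precede the original ones, so that an input
   out of range in [dec] stays out of range.  The second [GNand 0 0] is the
   constant [false], which becomes the verdict of [dec] when [dec] is empty. *)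
Definition new_decision (C : seq gate) (m h : nat) (dec : seq gate) : seq gate :=
  let G := h * size (link C) in
  chain m h (link C) ++ GNand 0 0 ::
  map (shift_gate (1 + h * m) (G + 2)) dec ++
  closing (G + 2 + size dec) G (1 + h.-1 * m).

Lemma new_decision_eval C m h dec a b : 0 < size C -> size a = 1 + h * m ->
  circuit_eval (a ++ b) (new_decision C m h dec) =
  [&& nth false (a ++ b) 0 ==> circuit_eval b dec,
      nth false (a ++ b) (1 + h.-1 * m) &
      all (fun k => circuit_eval (drop (1 + k * m) (a ++ b)) C) (iota 0 h)].
Proof.
move=> sC sa; rewrite /circuit_eval -!/(wires _ _ _) /new_decision.
set G := h * size (link C); rewrite wires_cat; case: (chain_wires (a ++ b) m h sC).
set W := wires _ _ (chain _ _ _) => W0 WG.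
have sW : size W = G.+1 by rewrite size_wires size_chain.
rewrite wires_cons /= W0 /= wires_cat.
set W' := rcons W false; have sW' : size W' = G + 2 by rewrite size_rcons sW addn2.
have -> : wires (a ++ b) W' (map (shift_gate (1 + h * m) (G + 2)) dec) =
          W' ++ wires b [::] dec.
  by have := wires_shift (a ++ b) W' [::] dec (1 + h * m); rewrite cats0 -sa drop_size_cat // sW' sa.
set U := W' ++ _; have sU : size U = G + 2 + size dec.
  by rewrite size_cat sW' size_wires.
rewrite -sU closing_wires; last by rewrite sU; lia.
have -> : nth false U G = nth false W G.
  by rewrite nth_cat sW' addn2 leqW // nth_rcons sW ltnSn.
rewrite WG; congr [&& _ ==> _, _ & _].
rewrite nth_last /U last_cat /W' last_rcons -/(wires _ _ _).
by case: (wires b [::] dec).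
Qed.

(** * The new instance *)

(** Address in the new proof at which level [k] starts. *)
Definition offset (r n k : nat) : nat := n + \sum_(j < k) 2 ^ (r - j).

Lemma offsetS r n k : offset r n k.+1 = offset r n k + 2 ^ (r - k).
Proof. by rewrite /offset big_ord_recr addnA. Qed.

Lemma offset0 r n : offset r n 0 = n.
Proof. by rewrite /offset big_ord0 addn0. Qed.

Lemma offset_le r n k l : k <= l -> offset r n k <= offset r n l.
Proof.
elim: l => [|l IH]; first by rewrite leqn0 => /eqP ->.
rewrite leq_eqVlt => /orP [/eqP -> //|kl]; apply: leq_trans (IH kl) _.
by rewrite offsetS leq_addr.
Qed.

Lemma offsetE r n k : k <= r.+1 -> offset r n k + 2 ^ (r.+1 - k) = n + 2 ^ r.+1.
Proof.
elim: k => [|k IH] kr; first by rewrite offset0.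
rewrite offsetS -IH; last exact: ltnW.
have -> : r.+1 - k = (r - k).+1 by lia.
by rewrite subSS expnS mul2n -addnn addnA.
Qed.

Lemma flatten_iota_split (T : Type) (f : nat -> seq T) k h : k < h ->
  flatten (map f (iota 0 h)) =
  flatten (map f (iota 0 k)) ++ f k ++ flatten (map f (iota k.+1 (h - k.+1))).
Proof.
move=> kh; have -> : h = k + (1 + (h - k.+1)) by lia.
rewrite !iotaD !map_cat !flatten_cat /= cats0 add0n addn1.
by have -> : k + (1 + (h - k.+1)) - k.+1 = h - k.+1 by lia.
Qed.

Lemma size_flatten_iota (T : Type) (f : nat -> seq T) m h :
  (forall k, k < h -> size (f k) = m) -> size (flatten (map f (iota 0 h))) = h * m.
Proof.
elim: h => [|h IH] fm //.
have -> : iota 0 h.+1 = iota 0 h ++ [:: h] by rewrite -addn1 iotaD.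
rewrite map_cat flatten_cat size_cat IH; last first.
  by move=> k kh; apply: fm; apply: leqW.
by rewrite /= cats0 fm // mulSn addnC.
Qed.

Lemma mkseq_nth_cat (T : Type) (x : T) s1 s2 :
  mkseq (nth x (s1 ++ s2)) (size s1) = s1.
Proof.
apply: (@eq_from_nth _ x); rewrite size_mkseq // => i si.
by rewrite nth_mkseq // nth_cat si.
Qed.

Section NewInstance.
Variable d : nat.

Section Queries.
Variables (r n : nat) (w : seq bool) (i : nat).

(** Reducing [i] modulo the size of level [k.+1] assigns every gate of that level to exactly
    [2 ^ k.+1] tests. The claimed output comes before the [d] inputs, as the gate-checking circuit
    expects. *)
Definition chunk (k : nat) : seq nat :=
  let g := i %% 2 ^ (r - k.+1) in
  offset r n k.+1 + g ::
  [seq offset r n k + v | v <- nth [::] (wiring d r w k) g].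

Lemma chunk_row k : nth [::] (wiring d r w k) (i %% 2 ^ (r - k.+1)) =
  gate_row d (r - k) (drop (i %% 2 ^ (r - k.+1) * (d * (r - k))) (tape_at d r k w)).
Proof.
apply: nth_wiring; have -> : (r - k).-1 = r - k.+1 by lia.
by rewrite ltn_mod expn_gt0.
Qed.

Lemma size_chunk k : size (chunk k) = d.+1.
Proof. by rewrite /= size_map chunk_row size_draws. Qed.

Lemma chunk_lt h k : k < h -> all (fun x => x < offset r n h.+1) (chunk k).
Proof.
move=> kh; have le1 : offset r n k.+2 <= offset r n h.+1 by apply: offset_le.
have le2 : offset r n k.+1 <= offset r n h.+1 by apply: offset_le; lia.
apply/andP; split.
  apply: leq_trans le1; rewrite [offset r n k.+2]offsetS ltn_add2l.
  by rewrite ltn_mod expn_gt0.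
apply/allP => _ /mapP [v vq ->]; apply: leq_trans le2.
rewrite offsetS ltn_add2l; rewrite chunk_row in vq.
exact: (allP (gate_row_lt _ _ _) _ vq).
Qed.

Definition extra (h : nat) : seq nat := n + i :: flatten (map chunk (iota 0 h)).

Lemma size_extra h : size (extra h) = 1 + h * d.+1.
Proof. by rewrite /= (@size_flatten_iota _ _ d.+1) // => k _; apply: size_chunk. Qed.

End Queries.

Variable C : seq gate.

Definition new_test (r h n : nat) (w : seq bool) (i : nat) (T : test) : test :=
  Test (extra r n w i h ++ queries T) (new_decision C d.+1 h (decision T)).

(** An implication rather than an equality: understating a bit cannot help the prover, because
    thresholds are monotone and the top bit has to be 1. *)
Definition passes (r h n : nat) (w : seq bool) (t : nat) (P : seq bool) (i : nat) : bool :=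
  let lev k g := nth false P (offset r n k + g) in
  (all (fun k => let g := i %% 2 ^ (r - k.+1) in
     lev k.+1 g ==> (t <= count (lev k) (nth [::] (wiring d r w k) g))) (iota 0 h)) &&
  lev h (i %% 2 ^ (r - h)).

(** Rank in the enumeration that [encode] follows, so that a program only has to count the tests and
    never decodes a random string. *)
Definition test_index (r : nat) (rho : r.-tuple bool) : nat := enum_rank rho.

Definition new_instance (h : nat) (I : instance) (w : seq bool) : instance :=
  Instance (offset (coins I) (proof_size I) h.+1)
    (fun rho : (coins I).-tuple bool =>
       new_test (coins I) h (proof_size I) w (test_index rho) (test_of rho)).

Lemma test_index_lt r (rho : r.-tuple bool) : test_index rho < 2 ^ r.
Proof.
by rewrite -[2]card_bool -[X in X ^ _]/(#|{: bool}|) -card_tuple; apply: ltn_ord.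
Qed.

Lemma new_instance_restricted h I w r q : restricted_instance r q I ->
  restricted_instance r (q + (1 + h * d.+1)) (new_instance h I w).
Proof.
case=> cI qI; split=> // rho; have [q1 q2] := qI rho; split.
  by rewrite size_cat size_extra addnC leq_add2r.
rewrite /= all_cat /=; apply/and3P; split.
- apply: leq_trans (offset_le _ _ (_ : 1 <= h.+1)) => //.
  by rewrite offsetS offset0 subn0 ltn_add2l test_index_lt.
- apply/allP => x /flattenP [_ /mapP [k + ->]]; rewrite mem_iota => /= kh xk.
  exact: (allP (chunk_lt _ _ _ _ kh) _ xk).
- apply/allP => x xq; apply: leq_trans (allP q2 _ xq) _.
  by rewrite -{1}(offset0 (coins I) (proof_size I)) offset_le.
Qed.

Variable t : nat.
Hypothesis C_gt0 : 0 < size C.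
Hypothesis C_eval : forall a, circuit_eval a C =
  (nth false a 0 ==> (t <= count id (mkseq (fun j => nth false a j.+1) d))).

Lemma accepts_new_test r h n w i T P : 0 < h ->
  accepts P (new_test r h n w i T) =
  (nth false P (n + i) ==> accepts P T) && passes r h n w t P i.
Proof.
move=> h0; rewrite /accepts map_cat new_decision_eval ?size_map ?size_extra //.
set a := map _ _ ++ _; rewrite -/(accepts P T).
have aE : a = nth false P (n + i) ::
    flatten [seq map (nth false P) (chunk r n w i k) | k <- iota 0 h] ++
    [seq nth false P j | j <- queries T].
  by rewrite /a /extra map_cons cat_cons map_flatten -map_comp.
have dropE k : k < h -> exists tl, drop (1 + k * d.+1) a =
    map (nth false P) (chunk r n w i k) ++ tl.
  move=> kh; eexists; rewrite aE add1n drop_cons.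
  rewrite (flatten_iota_split _ kh) -catA drop_size_cat; last first.
    by apply: size_flatten_iota => j _; rewrite size_map size_chunk.
  by rewrite -catA.
have -> : nth false a 0 = nth false P (n + i) by rewrite aE.
have -> : nth false a (1 + h.-1 * d.+1) =
    nth false P (offset r n h + i %% 2 ^ (r - h)).
  have hh : h.-1 < h by lia.
  have [tl tlE] := dropE _ hh.
  by rewrite -[1 + _]addn0 -nth_drop tlE /= prednK.
rewrite /passes [X in _ && X]andbC; congr [&& _ , _ & _].
apply: eq_in_all => k; rewrite mem_iota add0n => /andP [_ kh].
have [tl ->] := dropE _ kh; rewrite C_eval /=; congr (_ ==> (_ <= _)).
rewrite -map_comp; set q := nth _ _ _.
have sq : size q = d by rewrite /q chunk_row size_draws.
have key s : size s = d -> mkseq (nth false (s ++ tl)) d = s.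
  by move=> <-; apply: mkseq_nth_cat.
rewrite key; last by rewrite size_map.
by rewrite count_map.
Qed.

End NewInstance.

Lemma card_bits r : #|{: r.-tuple bool}| = 2 ^ r.
Proof. by rewrite card_tuple card_bool. Qed.

Lemma eq_ones F G n : (forall i, i < n -> F i = G i) -> ones F n = ones G n.
Proof. by move=> FG; apply: eq_bigr => i _; rewrite FG. Qed.

Lemma leq_ones2 (F G H : pred nat) n : (forall i, i < n -> F i -> G i || H i) ->
  ones F n <= ones G n + ones H n.
Proof.
move=> FGH; rewrite /ones -big_split /=; apply: leq_sum => i _.
by have := FGH i (ltn_ord i); case: (F i); case: (G i); case: (H i) => //= /(_ isT).
Qed.

Lemma leq_ones (F G : pred nat) n : (forall i, i < n -> F i -> G i) -> ones F n <= ones G n.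
Proof.
move=> FG; apply: leq_sum => i _.
by have := FG i (ltn_ord i); case: (F i); case: (G i) => //= /(_ isT).
Qed.

Lemma ones_cat (F : pred nat) a b :
  ones F (a + b) = ones F a + ones (fun v => F (a + v)) b.
Proof. exact: big_split_ord. Qed.

Lemma ones_mod F m N : ones (fun i => F (i %% N)) (m * N) = m * ones F N.
Proof.
elim: m => [|m IH]; first by rewrite mul0n /ones big_ord0.
rewrite mulSn addnC ones_cat IH mulSn addnC; congr (_ + _).
by apply: eq_ones => i iN; rewrite modnMDl modn_small.
Qed.

Lemma ones0P F n : reflect (forall i, i < n -> F i = false) (ones F n == 0).
Proof.
rewrite /ones sum_nat_eq0; apply: (iffP forallP) => [h i ilt|h i].
  by have := h (Ordinal ilt) => /=; case: (F i).
by rewrite /= h.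
Qed.

Section TestIndex.
Variables (r : nat) (rho0 : r.-tuple bool).

Lemma nth_test_index (rho : r.-tuple bool) :
  nth rho0 (enum {: r.-tuple bool}) (test_index rho) = rho.
Proof. exact: nth_enum_rank. Qed.

Lemma Pr_test_index (R : realType) (F : pred nat) :
  Pr R (fun rho : r.-tuple bool => F (test_index rho)) =
  ((ones F (2 ^ r))%:R / 2 ^+ r)%R.
Proof.
rewrite /Pr card_bits natrX; congr (_%:R / _)%R.
rewrite -sum1_card big_mkcond /= /ones -(big_mkord predT (fun v => (F v : nat))).
rewrite -card_bits big_mkord (reindex (@enum_rank {: r.-tuple bool})) /=; last first.
  exact: onW_bij (@enum_rank_bij _).
by apply: eq_bigr => rho _; rewrite inE asboolb; case: (F _).
Qed.

End TestIndex.

Lemma accepts_cat n P Q T : all (fun i => i < n) (queries T) -> size P = n ->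
  accepts (P ++ Q) T = accepts P T.
Proof.
move=> qn sP; rewrite /accepts; congr circuit_eval; apply/eq_in_map => i iq.
by rewrite nth_cat sP (allP qn _ iq).
Qed.

Definition sat_at (I : instance) (P : seq bool) (i : nat) : bool :=
  accepts P (@test_of I (nth [tuple of nseq (coins I) false] (enum {: (coins I).-tuple bool}) i)).

Lemma sat_at_index I P (rho : (coins I).-tuple bool) :
  sat_at I P (test_index rho) = accepts P (test_of rho).
Proof. by rewrite /sat_at nth_test_index. Qed.

(** * The new instance for a fixed wiring *)

Section Gap.
Variables (C : seq gate) (d t : nat).
Hypothesis C_gt0 : 0 < size C.
Hypothesis C_eval : forall a, circuit_eval a C =
  (nth false a 0 ==> (t <= count id (mkseq (fun j => nth false a j.+1) d))).
Variables (R : realType) (I : instance).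
Hypothesis queries_lt : forall rho : (coins I).-tuple bool,
  all (fun i => i < proof_size I) (queries (test_of rho)).
Variables (h : nat) (w : seq bool).
Hypothesis h_gt0 : 0 < h.
Hypothesis h_le : h <= coins I.
Let r := coins I.
Let n := proof_size I.

(** The honest proof appends the true levels to [P]. All verdict and gate checks then hold by
    construction, and only the top bits depend on the luck of the wiring. *)
Lemma new_instance_complete (P : n.-tuple bool) :
  ones (predC (level d t r (sat_at I P) w h)) (2 ^ (r - h)) = 0 ->
  completeness_ge (1 : R)%R (new_instance d C h I w).
Proof.
move/eqP/ones0P => allone; pose L := level d t r (sat_at I P) w.
pose bl k := mkseq (L k) (2 ^ (r - k)).
pose Q := P ++ flatten (map bl (iota 0 h.+1)).
have sbl k : size (flatten (map bl (iota 0 k))) = \sum_(j < k) 2 ^ (r - j).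
  elim: k => [|k IH]; first by rewrite big_ord0.
  have -> : iota 0 k.+1 = iota 0 k ++ [:: k] by rewrite -addn1 iotaD.
  by rewrite map_cat flatten_cat size_cat IH /= cats0 size_mkseq big_ord_recr.
have sQ : size Q == offset r n h.+1 by rewrite size_cat size_tuple sbl.
have QE k g : k <= h -> g < 2 ^ (r - k) -> nth false Q (offset r n k + g) = L k g.
  move=> kh gk; rewrite /Q (flatten_iota_split bl (kh : k < h.+1)).
  rewrite nth_cat size_tuple /offset -addnA ltnNge leq_addr /= addKn.
  rewrite nth_cat sbl ltnNge leq_addr /= addKn.
  by rewrite nth_cat size_mkseq gk nth_mkseq.
exists (Tuple sQ).
suff acc (rho : (coins I).-tuple bool) :
    accepts Q (new_test d C r h n w (test_index rho) (test_of rho)).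
  rewrite /Pr (_ : [set x | _] = setT); last first.
    by apply/setP => rho; rewrite !inE; apply/asboolP; apply: acc.
  by rewrite cardsT divff // pnatr_eq0 card_bits expn_eq0.
rewrite (accepts_new_test C_gt0 C_eval) // /passes /=; apply/and3P; split.
- rewrite (accepts_cat _ (queries_lt rho)) ?size_tuple // -sat_at_index.
  have := QE 0 (test_index rho) isT; rewrite offset0 subn0 => ->; first exact: implybb.
  by apply: test_index_lt.
- apply/allP => k; rewrite mem_iota add0n => /andP [_ kh].
  set g := _ %% _; have gk : g < 2 ^ (r - k.+1) by rewrite ltn_mod expn_gt0.
  rewrite QE //; apply/implyP; rewrite /L /= => /leq_trans; apply.
  rewrite (@eq_in_count _ (fun g => nth false Q (offset r n k + g)) (L k)) // => v; rewrite chunk_row => vq.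
  by rewrite QE ?(ltnW kh) //; apply: (allP (gate_row_lt _ _ _) _ vq).
- rewrite QE //; last by rewrite ltn_mod expn_gt0.
  by have := allone (test_index rho %% 2 ^ (r - h)); rewrite ltn_mod expn_gt0 /= => /(_ isT)/negbFE.
Qed.

Local Open Scope ring_scope.

Lemma new_instance_sound (s eta : R) :
  (forall k, (k < h)%N -> sampling (s + eta) s t (r - k) (wiring d r w k)) ->
  s + 2 * eta < 1 -> soundness_le s I -> soundness_le (1 - eta) (new_instance d C h I w).
Proof.
move=> samp se sI P; rewrite leNgt; apply/negP.
pose acc i := (nth false P (n + i) ==> sat_at I P i) && passes d r h n w t P i.
have -> : Pr R (fun rho : (coins (new_instance d C h I w)).-tuple bool =>
    accepts P (test_of rho)) = Pr R (fun rho : r.-tuple bool => acc (test_index rho)).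
  rewrite /Pr; congr (_%:R / _); apply: eq_card => rho; rewrite !inE.
  apply: asbool_equiv_eq; rewrite /acc sat_at_index.
  by rewrite [accepts _ _](accepts_new_test C_gt0 C_eval).
rewrite Pr_test_index ltr_pdivlMr ?exprn_gt0 // => accP.
pose lev k g := nth false P (offset r n k + g).
have rej : (ones (predC acc) (2 ^ r))%:R < eta * 2 ^+ r :> R.
  have := ones_predC acc (2 ^ r); move/(congr1 (fun x => x%:R : R)).
  rewrite natrD natrX; lra.
(* Every residue modulo [2 ^ (r - k)] has exactly [2 ^ k] tests above it, so gates whose watchers
   all reject are no denser in their level than rejecting tests are overall. *)
have fibre k (F : pred nat) : (k <= h)%N ->
    (forall i, (i < 2 ^ r)%N -> F (i %% 2 ^ (r - k))%N -> ~~ acc i) ->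
    (ones F (2 ^ (r - k)))%:R < eta * 2 ^+ (r - k) :> R.
  move=> kh FP; have kr : (k <= r)%N by apply: leq_trans h_le.
  have := leq_ones FP; have {2}-> : (2 ^ r = 2 ^ k * 2 ^ (r - k))%N.
    by rewrite -expnD subnKC.
  have -> : ones (fun i => F (i %% 2 ^ (r - k))%N) (2 ^ r) = (2 ^ k * ones F (2 ^ (r - k)))%N.
    by rewrite -ones_mod -expnD subnKC.
  rewrite -expnD subnKC // -(ler_nat R) natrM => le1.
  have := le_lt_trans le1 rej; rewrite -(subnKC kr) [in X in _ < X]exprD (addKn k).
  rewrite mulrCA natrX ltr_pM2l // exprn_gt0 //.
have claim k : (k <= h)%N ->
    (ones (lev k) (2 ^ (r - k)))%:R <= (s + eta) * 2 ^+ (r - k) :> R.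
  elim: k => [|k IH] kh.
    rewrite subn0.
    have sP : size (take n P) == proof_size I.
      rewrite size_takel // size_tuple /= -[X in (X <= _)%N](offset0 r n).
      exact: offset_le.
    have := sI (Tuple sP).
    have -> : Pr R (fun rho : (coins I).-tuple bool => accepts (Tuple sP) (test_of rho)) =
      Pr R (fun rho : r.-tuple bool => sat_at I (take n P) (test_index rho)).
      rewrite /Pr; congr (_%:R / _); apply: eq_card => rho; rewrite !inE.
      by apply: asbool_equiv_eq; rewrite sat_at_index.
    rewrite Pr_test_index ler_pdivrMr ?exprn_gt0 // => s1.
    (* A verdict claimed to be 1 is true of the old part of the proof, or its own test rejects. *)
    have : (ones (lev 0) (2 ^ r) <= ones (sat_at I (take n P)) (2 ^ r) + ones (predC acc) (2 ^ r))%N.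
      apply: leq_ones2 => i ir; rewrite /lev offset0 /= /acc => ->.
      have -> : sat_at I P i = sat_at I (take n P) i.
        rewrite /sat_at -{1}(cat_take_drop n P) (accepts_cat _ (queries_lt _)) //.
        exact/eqP.
      by case: (sat_at _ _ _); rewrite /= ?orbT.
    rewrite -(ler_nat R) natrD; lra.
  have sk := samp k kh (lev k) (IH (ltnW kh)).
  pose ev g := (t <= count (lev k) (nth [::] (wiring d r w k) g))%N.
  have evE : ones ev (2 ^ (r - k.+1)) = count (fun q => (t <= count (lev k) q)%N) (wiring d r w k).
    rewrite -(ones_count (fun q => (t <= count (lev k) q)%N)) size_wiring.
    by congr (ones _ (2 ^ _)); lia.
  have : (ones (lev k.+1) (2 ^ (r - k.+1)) <= ones ev (2 ^ (r - k.+1)) +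
       ones (fun g => lev k.+1 g && ~~ ev g) (2 ^ (r - k.+1)))%N.
    by apply: leq_ones2 => g _ ->; rewrite /= orbN.
  have bad := @fibre k.+1 (fun g => lev k.+1 g && ~~ ev g) kh.
  rewrite -(ler_nat R) natrD evE => le1.
  have rk : ((r - k).-1 = r - k.+1)%N by lia.
  rewrite rk in sk.
  have {}bad : (ones (fun g => lev k.+1 g && ~~ ev g) (2 ^ (r - k.+1)))%:R <
      eta * 2 ^+ (r - k.+1) :> R.
    apply: bad => i ir /andP [l1 l2]; rewrite /acc negb_and; apply/orP; right.
    rewrite /passes negb_and; apply/orP; left.
    apply/allPn; exists k; first by rewrite mem_iota.
    by rewrite /= -/(lev k.+1 _) l1.
  lra.
(* At the top, ones have density at most [s + eta] and zeros, each rejected by its watchers, less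
   than [eta]; the sum would be below 1. *)
have := claim h (leqnn h).
have := @fibre h (predC (lev h)) (leqnn h).
have := ones_predC (lev h) (2 ^ (r - h)); move/(congr1 (fun x => x%:R : R)).
rewrite natrD natrX => e1 f1 f2.
have {}f1 : (ones (predC (lev h)) (2 ^ (r - h)))%:R < eta * 2 ^+ (r - h) :> R.
  apply: f1 => i ir li; rewrite /acc negb_and; apply/orP; right.
  by rewrite /passes negb_and; apply/orP; right.
have x0 : 0 < 2 ^+ (r - h) :> R by rewrite exprn_gt0.
have : (s + 2 * eta) * 2 ^+ (r - h) < 1 * 2 ^+ (r - h) by rewrite ltr_pM2r.
lra.
Qed.

End Gap.

(** * Programs *)

(* Machine states whose registers form an explicit list, so that straight-line
   code can be executed by computation. *)
Record config := Config {
  cregs : seq nat;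
  cmem : nat -> nat;
  ctape : seq bool;
  cout : seq nat
}.

Definition state_of (s : config) : state :=
  State (nth 0 (cregs s)) (cmem s) (ctape s) (cout s).

Definition set_creg (x v : nat) (s : config) : config :=
  Config (set_nth 0 (cregs s) x v) (cmem s) (ctape s) (cout s).

Lemma set_regE x v s : set_reg x v (state_of s) = state_of (set_creg x v s).
Proof.
rewrite /set_reg /state_of /=; congr State; apply/funext => y.
by rewrite nth_set_nth /= /upd.
Qed.

Definition runs (c : com) (s : config) (T : nat) (s' : config) : Prop :=
  exists2 t, exec c (state_of s) t (state_of s') & t <= T.

Lemma runs_le c s T T' s' : T <= T' -> runs c s T s' -> runs c s T' s'.
Proof. by move=> TT [t ex le]; exists t => //; apply: leq_trans TT. Qed.

Lemma runs_seq a b s T1 s1 T2 s2 :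
  runs a s T1 s1 -> runs b s1 T2 s2 -> runs (Seq a b) s (T1 + T2) s2.
Proof.
move=> [t1 e1 l1] [t2 e2 l2]; exists (t1 + t2); last exact: leq_add.
exact: ExecSeq e1 e2.
Qed.

(** The invariant is the exact trajectory: [F i] is the whole configuration after [i] rounds. *)
Lemma runs_while x body (F : nat -> config) N T :
  (forall i, i < N -> nth 0 (cregs (F i)) x != 0) ->
  nth 0 (cregs (F N)) x = 0 ->
  (forall i, i < N -> runs body (F i) T (F i.+1)) ->
  runs (While x body) (F 0) (N * T.+1 + 1) (F N).
Proof.
elim: N F => [|N IH] F pos zero step.
  by exists 1 => //; apply: ExecWhileFalse.
have [t1 e1 l1] := step 0 isT.
have [|||t2 e2 l2] := IH (fun i => F i.+1) => //.
- by move=> i iN; apply: pos.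
- by move=> i iN; apply: step.
exists (t1 + t2).+1; last by lia.
by apply: ExecWhileTrue e1 e2; apply: pos.
Qed.

Lemma runs_for x body (F : nat -> config) N T sN :
  (forall i, nth 0 (cregs (F i)) x = N - i) ->
  (forall i, i < N -> runs body (F i) T (F i.+1)) ->
  F N = sN ->
  runs (While x body) (F 0) (N * T.+1 + 1) sN.
Proof.
move=> Fx step <-; apply: runs_while => //; last by rewrite Fx subnn.
by move=> i iN; rewrite Fx; lia.
Qed.

Fixpoint straight (c : com) : bool :=
  match c with
  | Seq a b | If _ a b => straight a && straight b
  | While _ _ => false
  | _ => true
  end.

Fixpoint cost (c : com) : nat :=
  match c with
  | Seq a b => cost a + cost b
  | If _ a b => (maxn (cost a) (cost b)).+1
  | _ => 1
  end.

(** The value on loops is a dummy, excluded by [straight] in [eval_runs]. Output is appended with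
    [++] so that goals normalise by associativity. *)
Fixpoint eval (c : com) (s : config) : config :=
  match c with
  | Skip | While _ _ => s
  | Const x n => set_creg x n s
  | Add x y z => set_creg x (nth 0 (cregs s) y + nth 0 (cregs s) z) s
  | Defs.Sub x y z => set_creg x (nth 0 (cregs s) y - nth 0 (cregs s) z) s
  | Fetch x y => set_creg x (cmem s (nth 0 (cregs s) y)) s
  | Store x y =>
      Config (cregs s) (upd (cmem s) (nth 0 (cregs s) x) (nth 0 (cregs s) y))
             (ctape s) (cout s)
  | Toss x =>
      Config (set_nth 0 (cregs s) x (head false (ctape s))) (cmem s)
             (behead (ctape s)) (cout s)
  | Emit x =>
      Config (cregs s) (cmem s) (ctape s) (cout s ++ [:: nth 0 (cregs s) x])
  | Seq a b => eval b (eval a s)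
  | If x a b => if nth 0 (cregs s) x != 0 then eval a s else eval b s
  end.

Lemma eval_runs c s : straight c -> runs c s (cost c) (eval c s).
Proof.
elim: c s => //=.
- by move=> s _; exists 1 => //; constructor.
- by move=> x n s _; exists 1 => //; rewrite -set_regE; constructor.
- by move=> x y z s _; exists 1 => //; rewrite -set_regE; constructor.
- by move=> x y z s _; exists 1 => //; rewrite -set_regE; constructor.
- by move=> x y s _; exists 1 => //; rewrite -set_regE; constructor.
- by move=> x y s _; exists 1 => //; constructor.
- move=> x s _; exists 1 => //.
  rewrite (_ : state_of (Config _ _ _ _) = State (upd (reg (state_of s)) x (head false (ctape s)))
                    (cmem s) (behead (ctape s)) (cout s)).
    exact: ExecToss.
  by have [] := set_regE x (head false (ctape s)) s; rewrite /state_of /= => <-.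
- by move=> x s _; exists 1 => //; rewrite /state_of /= cats1; constructor.
- by move=> a IHa b IHb s /andP [sa sb]; apply: runs_seq (IHa s sa) (IHb _ sb).
- move=> x a IHa b IHb s /andP [sa sb]; case: ifPn => [x0|/negPn/eqP x0].
    have [t e l] := IHa s sa; exists t.+1; first exact: ExecIfTrue.
    by rewrite ltnS leq_max l.
  have [t e l] := IHb s sb; exists t.+1; first exact: ExecIfFalse.
  by rewrite ltnS leq_max l orbT.
Qed.

Lemma runs_eval c s s' T : straight c -> cost c <= T -> eval c s = s' -> runs c s T s'.
Proof. by move=> sc cT <-; apply: runs_le cT _; apply: eval_runs. Qed.

Fixpoint seqs (cs : seq com) : com :=
  match cs with
  | [::] => Skip
  | [:: c] => c
  | c :: cs' => Seq c (seqs cs')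
  end.

Definition writes (m : nat -> nat) (ws : seq (nat * nat)) : nat -> nat :=
  foldl (fun m p => upd m p.1 p.2) m ws.

Lemma writes_cat m ws1 ws2 : writes m (ws1 ++ ws2) = writes (writes m ws1) ws2.
Proof. exact: foldl_cat. Qed.

Lemma writes_notin m ws x : (forall p, p \in ws -> p.1 != x) -> writes m ws x = m x.
Proof.
elim/last_ind: ws => [//|ws p IH] wx.
rewrite -cats1 writes_cat /= /upd eq_sym (negPf (wx p _)) ?mem_rcons ?mem_head //.
by apply: IH => p' p'w; apply: wx; rewrite mem_rcons in_cons p'w orbT.
Qed.

Lemma writes_in m ws x v : (x, v) \in ws -> (forall p, p \in ws -> p.1 = x -> p.2 = v) ->
  writes m ws x = v.
Proof.
elim/last_ind: ws => [//|ws p IH] xw wx.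
rewrite -cats1 writes_cat /= /upd; case: eqVneq => [xp|xp].
  by apply: wx => //; rewrite mem_rcons mem_head.
apply: IH.
  by move: xw; rewrite mem_rcons in_cons => /orP [/eqP pE|//]; rewrite -pE eqxx in xp.
by move=> p' p'w; apply: wx; rewrite mem_rcons in_cons p'w orbT.
Qed.

Notation SubC := Defs.Sub.

Lemma state_of_eq l l' m tp o : (forall x, nth 0 l x = nth 0 l' x) ->
  state_of (Config l m tp o) = state_of (Config l' m tp o).
Proof. by move=> ll; rewrite /state_of /=; congr State; apply/funext. Qed.

(* Registers: 0 input length, 1 the constant 1, 2 number r of coins, 3 old proof
   size, 4 and 5 the numbers 2^r and 2^(r+1), 6 depth, 7 number of extra queries,
   8 index of the last wire of the chain of links, 9 the constant 0, 10 next free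
   proof position (in the end the new proof size); the others are temporary. *)
Definition pow2 (dst cnt : nat) : com :=
  Seq (Const dst 1) (While cnt (Seq (Add dst dst dst) (SubC cnt cnt 1))).

Lemma pow2_runs (dst cnt : nat) l m tp o k :
  dst != cnt -> dst != 1 -> cnt != 1 -> nth 0 l 1 = 1 -> nth 0 l cnt = k ->
  runs (pow2 dst cnt) (Config l m tp o) (k * 3 + 2)
       (Config (set_nth 0 (set_nth 0 l dst (2 ^ k)) cnt 0) m tp o).
Proof.
move=> dc d1 c1 l1 lk.
pose F i := Config (set_nth 0 (set_nth 0 l dst (2 ^ i)) cnt (k - i)) m tp o.
have -> : k * 3 + 2 = 1 + (k * 3 + 1) by lia.
apply: (@runs_seq _ _ _ _ (F 0)).
  exists 1 => //; rewrite (_ : state_of (F 0) = set_reg dst 1 (state_of (Config l m tp o))).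
    exact: ExecConst.
  rewrite set_regE; apply: state_of_eq => x; rewrite subn0 !nth_set_nth /=.
  case: (eqVneq x cnt) => [->|_]; last by rewrite nth_set_nth.
  by rewrite [cnt == dst]eq_sym (negPf dc) lk.
apply: (@runs_for cnt _ F k 2); last by rewrite /F subnn.
  by move=> i; rewrite nth_set_nth /= eqxx.
move=> i ik.
  have [t e le] := @eval_runs (Seq (Add dst dst dst) (SubC cnt cnt 1)) (F i) isT.
  exists t => //; move: e; congr exec; apply: state_of_eq => x.
  have cd : (cnt == dst) = false by rewrite eq_sym; apply: negPf.
  have d1' : (1 == dst) = false by rewrite eq_sym; apply: negPf.
  have c1' : (1 == cnt) = false by rewrite eq_sym; apply: negPf.
  do 4![rewrite ?nth_set_nth /= ?(cd, negPf dc, d1', c1', eqxx)]; rewrite l1.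
  case: (eqVneq x cnt) => [_|_]; first by lia.
  by rewrite ?nth_set_nth /=; case: eqP => // _; rewrite expnS; lia.
Qed.

(** * Drawing the wiring and tabulating it in memory *)

Section Wiring.
Variables (d L r n m m2 h e W : nat).

Notation RG z t := [:: L, 1, r, n, m, m2, h, e, W, 0, z & t].

(** Temporaries such as register 20 are cleared in each round, so that the configuration at the loop
    head has a fixed shape in the loop counter. *)
Definition bits_loop : com :=
  While 19 (seqs [:: Add 18 18 18; Toss 20; Add 18 18 20; Const 20 0; SubC 19 19 1]).

Lemma bits_loop_runs z O B c a N j c' M tp o :
  runs bits_loop
    (Config (RG z [:: O; B; c; 0; N; a; j; 0; B; 0; c'; 0; 0]) M tp o) (B * 6 + 1)
    (Config (RG z [:: O; B; c; 0; N; a; j; num B tp; 0; 0; c'; 0; 0]) M (drop B tp) o).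
Proof.
pose F i := Config (RG z [:: O; B; c; 0; N; a; j; num i tp; B - i; 0; c'; 0; 0])
              M (drop i tp) o.
have -> : Config (RG z [:: O; B; c; 0; N; a; j; 0; B; 0; c'; 0; 0]) M tp o = F 0.
  by rewrite /F subn0 drop0.
apply: (@runs_for 19 _ F B 5) => //; last by rewrite /F subnn.
move=> i iB; apply: runs_eval => //=; rewrite /set_creg /F /= numS -drop1 drop_drop add1n.
have -> : head false (drop i tp) = nth false tp i by rewrite -nth0 nth_drop addn0.
by have -> : B - i - 1 = B - i.+1 by lia.
Qed.

(* The j-th input of the gate at proof position z is kept at address
   L + z + j 2^(r+1), beyond the L cells of the input. *)
Definition row_writes (a O B : nat) (tp : seq bool) : seq (nat * nat) :=
  mkseq (fun j => (a + j * m2, num B (drop (j * B) tp) + O)) d.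

Definition slot_loop : com :=
  While 17 (seqs [:: Const 18 0; Add 19 12 9; bits_loop;
    seqs [:: Add 18 18 11; Store 16 18; Const 18 0; Add 16 16 5; SubC 17 17 1]]).

Lemma slot_loop_runs z O B c N a c' M tp o X : 0 < X -> B <= X ->
  runs slot_loop
    (Config (RG z [:: O; B; c; 0; N; a; d; 0; 0; 0; c'; 0; 0]) M tp o) ((15 * d + 1) * X)
    (Config (RG z [:: O; B; c; 0; N; a + d * m2; 0; 0; 0; 0; c'; 0; 0])
       (writes M (row_writes a O B tp)) (drop (d * B) tp) o).
Proof.
move=> X0 BX.
pose F i := Config (RG z [:: O; B; c; 0; N; a + i * m2; d - i; 0; 0; 0; c'; 0; 0])
    (writes M (mkseq (fun j => (a + j * m2, num B (drop (j * B) tp) + O)) i))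
    (drop (i * B) tp) o.
have -> : Config (RG z [:: O; B; c; 0; N; a; d; 0; 0; 0; c'; 0; 0]) M tp o = F 0.
  by rewrite /F subn0 mul0n drop0 addn0.
apply: (@runs_le _ _ (d * (X * 14).+1 + 1)); first by nia.
apply: (@runs_for 17 _ F) => //; last by rewrite /F subnn.
move=> i id; apply: (@runs_le _ _ (1 + (1 + (B * 6 + 1 + 5)))); first by lia.
apply: runs_seq; first exact: eval_runs.
apply: runs_seq; first exact: eval_runs.
rewrite /= /set_creg /= addn0; apply: runs_seq; first exact: bits_loop_runs.
apply: runs_eval => //; rewrite /F mkseqS -cats1 writes_cat /= /set_creg /=.
rewrite drop_drop; congr Config.
by do ![congr cons]; lia.
Qed.

Definition gate_loop : com :=
  While 15 (Seq (seqs [:: Add 16 0 10; Const 17 d])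
           (Seq slot_loop (seqs [:: Const 16 0; Add 10 10 1; SubC 15 15 1]))).

Definition gate_writes (z O B N : nat) (tp : seq bool) : seq (nat * nat) :=
  flatten (mkseq (fun g => row_writes (L + (z + g)) O B (drop (g * (d * B)) tp)) N).

Lemma gate_loop_runs z O B c N c' M tp o X : 0 < X -> B <= X -> N <= X ->
  runs gate_loop
    (Config (RG z [:: O; B; c; 0; N; 0; 0; 0; 0; 0; c'; 0; 0]) M tp o)
    ((15 * d + 8) * X ^ 2)
    (Config (RG (z + N) [:: O; B; c; 0; 0; 0; 0; 0; 0; 0; c'; 0; 0])
       (writes M (gate_writes z O B N tp)) (drop (N * (d * B)) tp) o).
Proof.
move=> X0 BX NX.
pose F i := Config (RG (z + i) [:: O; B; c; 0; N - i; 0; 0; 0; 0; 0; c'; 0; 0])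
    (writes M (gate_writes z O B i tp)) (drop (i * (d * B)) tp) o.
have -> : Config (RG z [:: O; B; c; 0; N; 0; 0; 0; 0; 0; c'; 0; 0]) M tp o = F 0.
  by rewrite /F subn0 mul0n drop0 addn0.
apply: (@runs_le _ _ (N * ((15 * d + 6) * X).+1 + 1)); first by nia.
apply: (@runs_for 15 _ F) => //; last by rewrite /F subnn.
move=> i iN; apply: (@runs_le _ _ (2 + ((15 * d + 1) * X + 3))); first by nia.
apply: runs_seq; first exact: eval_runs.
rewrite /= /set_creg /=; apply: runs_seq; first by apply: slot_loop_runs.
apply: runs_eval => //; rewrite /F /gate_writes mkseqS flatten_rcons writes_cat.
rewrite /= /set_creg /=.
rewrite drop_drop; congr Config.
by do ![congr cons]; lia.
Qed.

Definition layer_loop : com :=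
  While 13 (Seq (SubC 14 12 1) (Seq (pow2 15 14) (Seq (Add 21 10 9)
    (Seq gate_loop (seqs [:: Add 11 21 9; Const 21 0; SubC 12 12 1; SubC 13 13 1]))))).

Definition layer_writes (tp : seq bool) (k : nat) : seq (nat * nat) :=
  gate_writes (offset r n k.+1) (offset r n k) (r - k) (2 ^ (r - k).-1) (tape_at d r k tp).

Lemma layer_loop_runs M tp o X : 0 < X -> 2 ^ r <= X -> h <= r ->
  runs layer_loop
    (Config (RG (offset r n 1) [:: n; r; h; 0; 0; 0; 0; 0; 0; 0; 0; 0; 0]) M tp o)
    ((15 * d + 20) * X ^ 3)
    (Config (RG (offset r n h.+1) [:: offset r n h; r - h; 0; 0; 0; 0; 0; 0; 0; 0; 0; 0; 0])
       (writes M (flatten (mkseq (layer_writes tp) h))) (tape_at d r h tp) o).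
Proof.
move=> X0 rX hr; have rX' : r <= X by apply: leq_trans rX; apply/ltnW/ltn_expl.
pose F i := Config (RG (offset r n i.+1)
    [:: offset r n i; r - i; h - i; 0; 0; 0; 0; 0; 0; 0; 0; 0; 0])
    (writes M (flatten (mkseq (layer_writes tp) i))) (tape_at d r i tp) o.
have -> : Config (RG (offset r n 1) [:: n; r; h; 0; 0; 0; 0; 0; 0; 0; 0; 0; 0]) M tp o = F 0.
  by rewrite /F !subn0 offset0.
apply: (@runs_le _ _ (h * ((15 * d + 18) * X ^ 2).+1 + 1)); first by rewrite [X ^ 3]expnS; nia.
apply: (@runs_for 13 _ F) => //; last by rewrite /F subnn.
move=> i ih; set B := r - i.
have NX : 2 ^ B.-1 <= X by apply: leq_trans rX; rewrite leq_exp2l // /B; lia.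
have BX : B <= X by rewrite /B; lia.
apply: (@runs_le _ _ (1 + (B.-1 * 3 + 2 + (1 + ((15 * d + 8) * X ^ 2 + 4))))); first by nia.
apply: runs_seq; first exact: eval_runs.
apply: runs_seq.
  by apply: pow2_runs => //=; rewrite subn1.
rewrite /= /set_creg /=; apply: runs_seq; first exact: eval_runs.
rewrite /= /set_creg /= addn0 /=; apply: runs_seq; first by apply: gate_loop_runs.
apply: runs_eval => //; rewrite /F mkseqS flatten_rcons writes_cat tape_atS.
rewrite /= /set_creg /= addn0; congr Config.
rewrite [offset r n i.+2]offsetS.
have -> : r - i.+1 = B.-1 by rewrite /B; lia.
by do ![congr cons]; rewrite ?subn1 //; lia.
Qed.

End Wiring.

Definition mem_at (M : nat -> nat) (p : nat) (s : seq nat) : Prop :=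
  forall x, x < size s -> M (p + x) = nth 0 s x.

Lemma mem_at_cat M p s1 s2 :
  mem_at M p (s1 ++ s2) -> mem_at M p s1 /\ mem_at M (p + size s1) s2.
Proof.
move=> Ms; split=> x xs.
  by rewrite Ms ?size_cat ?nth_cat ?xs // ltn_addr.
rewrite -addnA Ms; last by rewrite size_cat ltn_add2l.
by rewrite nth_cat ltnNge leq_addr /= addKn.
Qed.

Lemma mem_at_cons M p x s : mem_at M p (x :: s) -> M p = x /\ mem_at M p.+1 s.
Proof.
move=> Ms; have := Ms 0 isT; rewrite addn0 => /= Mp; split=> // y ys.
by rewrite addSnnS; apply: Ms.
Qed.

(** Unfolding only the machine and list operations leaves arithmetic folded, so that results can be
    compared with the intended configuration. *)
Ltac execute := lazy beta iota zeta delta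
  [seqs eval set_creg cregs cmem ctape cout nth set_nth].

(** * Writing out one new test *)

Section Emission.
Variables (d : nat) (C : seq gate) (L r n m h e W : nat).

Notation RG z t := [:: L, 1, r, n, m, m + m, h, e, W, 0, z & t].

Definition fetch_loop : com :=
  While 22 (seqs [:: Fetch 23 21; Emit 23; Add 21 21 5; Const 23 0; SubC 22 22 1]).

Lemma fetch_loop_runs z p i c q O B g c' N a M tp o :
  runs fetch_loop
    (Config (RG z [:: p; i; c; q; O; B; g; c'; 0; N; a; d; 0]) M tp o) (d * 6 + 1)
    (Config (RG z [:: p; i; c; q; O; B; g; c'; 0; N; a + d * (m + m); 0; 0]) M tp
       (o ++ mkseq (fun j => M (a + j * (m + m))) d)).
Proof.
pose F k := Config (RG z [:: p; i; c; q; O; B; g; c'; 0; N; a + k * (m + m); d - k; 0]) M tp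
       (o ++ mkseq (fun j => M (a + j * (m + m))) k).
have -> : Config (RG z [:: p; i; c; q; O; B; g; c'; 0; N; a; d; 0]) M tp o = F 0.
  by rewrite /F subn0 mul0n addn0 cats0.
apply: (@runs_for 22 _ F d 5) => //; last by rewrite /F subnn.
move=> k kd; apply: runs_eval => //; rewrite /F mkseqS -cats1 catA /= /set_creg /=.
by congr Config; do ![congr cons]; lia.
Qed.

Definition chunk_loop : com :=
  While 18 (Seq (seqs [:: SubC 16 16 1; Add 19 16 9]) (Seq (pow2 20 19)
    (Seq (seqs [:: Add 21 17 1; SubC 21 21 20; If 21 (SubC 17 17 20) Skip;
                   Add 21 15 17; Emit 21; Add 21 21 0; Const 22 d])
    (Seq fetch_loop
      (seqs [:: Const 21 0; Add 15 15 20; Const 20 0; SubC 18 18 1]))))).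

Variables (M : nat -> nat) (w : seq bool).
Hypothesis table : forall k g j, k < h -> g < 2 ^ (r - k.+1) -> j < d ->
  M (offset r n k.+1 + g + L + j * (m + m)) =
  offset r n k + nth 0 (nth [::] (wiring d r w k) g) j.

(** The machine has no division: residues for successive levels are obtained by one conditional
    subtraction each. The truncated difference [g + 1 - N] is nonzero exactly when [g >= N]. *)
Lemma modn_half i B : 0 < B ->
  i %% 2 ^ B.-1 =
  if i %% 2 ^ B + 1 - 2 ^ B.-1 != 0 then i %% 2 ^ B - 2 ^ B.-1 else i %% 2 ^ B.
Proof.
move=> B0; set N := 2 ^ B.-1.
have BN : 2 ^ B = 2 * N by rewrite /N -expnS prednK.
have N0 : 0 < N by rewrite expn_gt0.
have -> : i %% N = (i %% 2 ^ B) %% N by rewrite modn_dvdm // BN dvdn_mull.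
have : i %% 2 ^ B < 2 * N by rewrite -BN ltn_mod expn_gt0.
move: (i %% 2 ^ B) => g gN; case: ifPn => gN'.
  have -> : g = N + (g - N) by lia.
  by rewrite modnDl addKn modn_small //; lia.
by rewrite modn_small //; lia.
Qed.

Lemma chunk_loop_runs z p i c q tp o X :
  i < 2 ^ r -> h <= r -> 2 ^ r <= X ->
  runs chunk_loop
    (Config (RG z [:: p; i; c; q; offset r n 1; r; i; h; 0; 0; 0; 0; 0]) M tp o)
    ((6 * d + 22) * X ^ 2)
    (Config (RG z [:: p; i; c; q; offset r n h.+1; r - h; i %% 2 ^ (r - h); 0; 0; 0; 0; 0; 0]) M tp
       (o ++ flatten (mkseq (chunk d r n w i) h))).
Proof.
move=> ir hr rX; have rX' : r < X by apply: leq_trans rX; apply: ltn_expl.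
pose F k := Config (RG z [:: p; i; c; q; offset r n k.+1; r - k; i %% 2 ^ (r - k); h - k; 0; 0; 0; 0; 0])
   M tp (o ++ flatten (mkseq (chunk d r n w i) k)).
have -> : Config (RG z [:: p; i; c; q; offset r n 1; r; i; h; 0; 0; 0; 0; 0]) M tp o = F 0.
  by rewrite /F !subn0 modn_small //= cats0.
apply: (@runs_le _ _ (h * ((6 * d + 20) * X).+1 + 1)); first by nia.
apply: (@runs_for 18 _ F) => //; last by rewrite /F subnn.
move=> k kh; apply: (@runs_le _ _ (2 + ((r - k).-1 * 3 + 2 + (8 + (d * 6 + 1 + 4))))).
  by nia.
apply: runs_seq; first exact: eval_runs.
apply: runs_seq; first by apply: pow2_runs => //=; rewrite addn0 subn1.
rewrite /= /set_creg /= subn1.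
set B := r - k; set N := 2 ^ B.-1; set g := i %% N.
have B0 : 0 < B by rewrite /B; lia.
have rB : r - k.+1 = B.-1 by rewrite /B; lia.
have gN : g < N by rewrite ltn_mod expn_gt0.
apply: runs_seq.
  apply: (@runs_eval _ _ (Config (RG z
    [:: p; i; c; q; offset r n k.+1; B.-1; g; h - k; 0; N; offset r n k.+1 + g + L; d; 0]) M tp
    (o ++ flatten (mkseq (chunk d r n w i) k) ++ [:: offset r n k.+1 + g]))) => //=.
  rewrite /g (modn_half i B0) -/N /set_creg /= catA.
  by case: ifP.
apply: runs_seq; first exact: fetch_loop_runs.
apply: runs_eval => //; rewrite /F mkseqS flatten_rcons.
rewrite /= /set_creg /= -!catA [offset r n k.+2]offsetS rB; congr Config.
  by do ![congr cons]; lia.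
congr (_ ++ (_ ++ _)); rewrite /chunk rB -/N -/g /=; congr (_ :: _).
have sq := chunk_row d r w i k; rewrite rB -/N -/g in sq.
apply: (@eq_from_nth _ 0); first by rewrite size_mkseq size_map sq size_draws.
move=> j; rewrite size_mkseq => jd; rewrite nth_mkseq // table ?rB //.
by rewrite (nth_map 0) // sq size_draws.
Qed.

Definition copy_loop : com :=
  While 14 (seqs [:: Fetch 15 11; Emit 15; Add 11 11 1; Const 15 0; SubC 14 14 1]).

Lemma copy_loop_runs z p i c s tp o : mem_at M p s ->
  runs copy_loop
    (Config (RG z [:: p; i; c; size s; 0; 0; 0; 0; 0; 0; 0; 0; 0]) M tp o) (size s * 6 + 1)
    (Config (RG z [:: p + size s; i; c; 0; 0; 0; 0; 0; 0; 0; 0; 0; 0]) M tp (o ++ s)).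
Proof.
move=> Ms.
pose F k := Config (RG z [:: p + k; i; c; size s - k; 0; 0; 0; 0; 0; 0; 0; 0; 0]) M tp (o ++ take k s).
have -> : Config (RG z [:: p; i; c; size s; 0; 0; 0; 0; 0; 0; 0; 0; 0]) M tp o = F 0.
  by rewrite /F subn0 addn0 take0 cats0.
apply: (@runs_for 14 _ F _ 5) => //; last by rewrite /F subnn take_size.
move=> k ks; apply: runs_eval => //; rewrite /F (take_nth 0) // -cats1 catA /= /set_creg /=.
by rewrite Ms //; congr Config; do ![congr cons]; lia.
Qed.

Definition emit_gate (g : gate) : com :=
  match g with
  | GInput x => seqs [:: Emit 9; Const 20 x; Add 20 15 20; Emit 20; Emit 9]
  | GNand x y => seqs [:: Emit 1; Const 20 x; Add 20 16 20; Emit 20;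
                          Const 20 y; Add 20 16 20; Emit 20]
  end.

(** Used for the link circuit, which is a constant of the reduction and can be unrolled into
    straight-line code; the old decision circuit is data and takes a loop. *)
Definition emit_gates (D : seq gate) : com :=
  foldr (fun g c => Seq (emit_gate g) c) (Const 20 0) D.

Definition encode_gates (D : seq gate) : seq nat := flatten (map encode_gate D).

Lemma encode_gates_cat D1 D2 :
  encode_gates (D1 ++ D2) = encode_gates D1 ++ encode_gates D2.
Proof. by rewrite /encode_gates map_cat flatten_cat. Qed.

Lemma emit_gates_runs z p i c q bi bw c17 c18 c19 D tp o :
  runs (emit_gates D)
    (Config (RG z [:: p; i; c; q; bi; bw; c17; c18; c19; 0; 0; 0; 0]) M tp o)
    (7 * size D + 1)
    (Config (RG z [:: p; i; c; q; bi; bw; c17; c18; c19; 0; 0; 0; 0]) M tp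
       (o ++ encode_gates (map (shift_gate bi bw) D))).
Proof.
apply: runs_eval.
- by elim: D => //= g D ->; case: g.
- by elim: D => //= g D IH; case: g => /= *; lia.
have gen x : eval (emit_gates D)
    (Config (RG z [:: p; i; c; q; bi; bw; c17; c18; c19; x; 0; 0; 0]) M tp o) =
    Config (RG z [:: p; i; c; q; bi; bw; c17; c18; c19; 0; 0; 0; 0]) M tp
       (o ++ encode_gates (map (shift_gate bi bw) D)).
  elim: D o x => [|g D IH] o x; first by rewrite cats0.
  by case: g => [y|y y'] /=; rewrite /set_creg /= IH /= -!catA.
exact: gen.
Qed.

Definition chain_loop : com :=
  While 17 (Seq (emit_gates (link C))
               (seqs [:: Add 15 15 18; Add 16 16 19; SubC 17 17 1])).

Lemma chain_loop_runs z p i c q tp o X : h < X ->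
  runs chain_loop
    (Config (RG z [:: p; i; c; q; 1; 0; h; d.+1; size (link C); 0; 0; 0; 0]) M tp o)
    ((7 * size (link C) + 5) * X)
    (Config (RG z [:: p; i; c; q; 1 + h * d.+1; h * size (link C); 0; d.+1; size (link C); 0; 0; 0; 0]) M tp
       (o ++ encode_gates (behead (chain d.+1 h (link C))))).
Proof.
move=> hX; set G := size (link C).
pose F k := Config (RG z [:: p; i; c; q; 1 + k * d.+1; k * G; h - k; d.+1; G; 0; 0; 0; 0]) M tp
       (o ++ encode_gates (behead (chain d.+1 k (link C)))).
have -> : Config (RG z [:: p; i; c; q; 1; 0; h; d.+1; G; 0; 0; 0; 0]) M tp o = F 0.
  by rewrite /F subn0 cats0.
apply: (@runs_le _ _ (h * (7 * G + 1 + 3).+1 + 1)); first by nia.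
apply: (@runs_for 17 _ F) => //; last by rewrite /F subnn.
move=> k kh; apply: runs_seq; first exact: emit_gates_runs.
apply: runs_eval => //; rewrite /F chainS.
have -> : behead (chain d.+1 k (link C) ++ map (shift_gate (1 + k * d.+1) (k * size (link C))) (link C)) =
   behead (chain d.+1 k (link C)) ++ map (shift_gate (1 + k * d.+1) (k * G)) (link C) by [].
rewrite encode_gates_cat /= /set_creg /= catA; congr Config.
by do ![congr cons]; lia.
Qed.

Definition shift_loop : com :=
  While 14 (seqs [:: Fetch 18 11; Add 11 11 1; Fetch 19 11; Add 11 11 1;
     Fetch 20 11; Add 11 11 1; Emit 18;
     If 18 (Seq (Add 19 16 19) (Add 20 16 20)) (Add 19 7 19);
     Emit 19; Emit 20; seqs [:: Const 18 0; Const 19 0; Const 20 0; SubC 14 14 1]]).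

Lemma size_encode_gates D : size (encode_gates D) = 3 * size D.
Proof.
by elim: D => //= g D IH; rewrite /encode_gates /= size_cat -/(encode_gates D) IH; case: g => /= *; lia.
Qed.

Lemma shift_loop_runs z p i c bw u D tp o : mem_at M p (encode_gates D) ->
  runs shift_loop
    (Config (RG z [:: p; i; c; size D; 0; bw; u; 0; 0; 0; 0; 0; 0]) M tp o) (size D * 18 + 1)
    (Config (RG z [:: p + size (encode_gates D); i; c; 0; 0; bw; u; 0; 0; 0; 0; 0; 0]) M tp
       (o ++ encode_gates (map (shift_gate e bw) D))).
Proof.
move=> MD.
pose F k := Config (RG z [:: p + 3 * k; i; c; size D - k; 0; bw; u; 0; 0; 0; 0; 0; 0]) M tp
       (o ++ encode_gates (map (shift_gate e bw) (take k D))).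
have -> : Config (RG z [:: p; i; c; size D; 0; bw; u; 0; 0; 0; 0; 0; 0]) M tp o = F 0.
  by rewrite /F subn0 addn0 take0 cats0.
apply: (@runs_for 14 _ F _ 17) => //; last by rewrite /F subnn take_size size_encode_gates.
move=> k kD; apply: runs_eval => //; rewrite /F (take_nth (GInput 0)) // map_rcons -cats1.
set g := nth _ _ _; rewrite encode_gates_cat.
have {}MD : mem_at M (p + 3 * k) (encode_gate g).
  have DE : D = take k D ++ g :: drop k.+1 D by rewrite -drop_nth // cat_take_drop.
  move: MD; rewrite {1}DE encode_gates_cat => /mem_at_cat [_].
  rewrite size_encode_gates size_takel; last exact: ltnW.
  by rewrite -cat1s encode_gates_cat => /mem_at_cat [+ _]; rewrite /encode_gates /= cats0.
have s3 : size (encode_gate g) = 3 by case: g {MD}.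
have M0 := MD 0; have M1 := MD 1; have M2 := MD 2; rewrite s3 in M0 M1 M2.
rewrite /= /set_creg /=.
have -> : M (p + 3 * k) = nth 0 (encode_gate g) 0 by rewrite -M0 // addn0.
have -> : M (p + 3 * k + 1 + 1) = nth 0 (encode_gate g) 2 by rewrite -M2 // -addnA.
rewrite M1 //.
by case: g {MD s3 M0 M1 M2} => [x|x y] /=; congr Config; rewrite ?[_ ++ _]catA -?catA //;
  do ![congr cons]; lia.
Qed.

Definition closing_code : com :=
  seqs [:: Emit 9; Emit 9; Emit 9;
           SubC 18 17 1; Emit 1; Emit 18; Emit 18;
           Add 18 17 1; Emit 1; Emit 17; Emit 18;
           Const 19 d.+1; SubC 19 7 19; Emit 9; Emit 19; Emit 9;
           Add 18 18 1; Add 19 18 1; Emit 1; Emit 18; Emit 19;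
           Add 18 19 1; Emit 1; Emit 18; Emit 18;
           Add 18 18 1; Emit 1; Emit 18; Emit 8;
           Add 18 18 1; Emit 1; Emit 18; Emit 18;
           Const 16 0; Const 17 0; Const 18 0; Const 19 0].

Lemma closing_code_runs z p i c bw u tp o : 0 < h -> e = 1 + h * d.+1 ->
  runs closing_code
    (Config (RG z [:: p; i; c; 0; 0; bw; u; 0; 0; 0; 0; 0; 0]) M tp o) 37
    (Config (RG z [:: p; i; c; 0; 0; 0; 0; 0; 0; 0; 0; 0; 0]) M tp
       (o ++ encode_gates (closing u W (1 + h.-1 * d.+1)))).
Proof.
move=> h0 eE; apply: runs_eval => //; rewrite /closing_code; execute.
rewrite -!catA /encode_gates /= -!addnA !subn1.
have -> : e - d.+1 = 1 + h.-1 * d.+1 by rewrite eE -[h in LHS](prednK h0) mulSn addnCA addKn.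
by [].
Qed.

Definition test_code : com :=
  seqs [:: seqs [:: Fetch 14 11; Add 11 11 1; Add 15 7 14; Emit 15; Add 15 3 12; Emit 15;
                    Add 15 3 4; Add 16 2 9; Add 17 12 9; Add 18 6 9];
           chunk_loop;
           seqs [:: Const 15 0; Const 16 0; Const 17 0];
           copy_loop;
           seqs [:: Fetch 14 11; Add 11 11 1; Const 15 10; Add 15 15 8; Add 15 15 14; Emit 15;
                    Emit 1; Emit 9; Emit 9;
                    Const 15 1; Add 17 6 9; Const 18 d.+1; Const 19 (size (link C))];
           chain_loop;
           seqs [:: Const 15 0; Const 18 0; Const 19 0; Emit 1; Emit 9; Emit 9;
                    Const 16 2; Add 16 8 16; Add 17 16 14];
           shift_loop; closing_code;
           seqs [:: Add 12 12 1; SubC 13 13 1]].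

Lemma test_code_runs z p i c T tp o X :
  0 < h -> h <= r -> i < 2 ^ r -> 2 ^ r <= X -> m = 2 ^ r ->
  e = 1 + h * d.+1 -> W = h * size (link C) ->
  size (queries T) <= X -> size (decision T) <= X ->
  mem_at M p (encode_test T) ->
  runs test_code
    (Config (RG z [:: p; i; c; 0; 0; 0; 0; 0; 0; 0; 0; 0; 0]) M tp o)
    ((6 * d + 7 * size (link C) + 130) * X ^ 2)
    (Config (RG z [:: p + size (encode_test T); i.+1; c.-1; 0; 0; 0; 0; 0; 0; 0; 0; 0; 0]) M tp
       (o ++ encode_test (new_test d C r h n w i T))).
Proof.
move=> h0 hr ir rX mE eE WE qX DX.
set fin := Config _ _ _ (o ++ _).
set Q := queries T; set D := decision T; set G := size (link C).
rewrite /encode_test -/Q -/D => /mem_at_cons [Mq] /mem_at_cat [MQ] /mem_at_cons [Md MD].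
have X0 : 0 < X by apply: leq_trans rX; rewrite expn_gt0.
have hX : h < X by apply: leq_ltn_trans hr _; apply: leq_trans rX; apply: ltn_expl.
have sND : size (new_decision C d.+1 h D) = 10 + W + size D.
  rewrite /new_decision !size_cat size_chain [size (_ :: _)]/= size_cat size_map /= WE -/G.
  by clear; lia.
apply: (@runs_le _ _ (10 + ((6 * d + 22) * X ^ 2 + (3 + (size Q * 6 + 1 + (13 +
  ((7 * G + 5) * X + (9 + (size D * 18 + 1 + (37 + 2)))))))))).
  have XY : X <= X ^ 2 by rewrite -{1}[X]expn1 leq_pexp2l.
  move: (X ^ 2) XY (leq_mul (leqnn G) XY) => Y XY GY.
  move: qX DX; rewrite -/Q -/D => qX DX; clear -X0 XY GY qX DX; lia.
apply: runs_seq.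
  apply: (@runs_eval _ _ (Config (RG z [:: p.+1; i; c; size Q; offset r n 1; r; i; h; 0; 0; 0; 0; 0])
     M tp (o ++ [:: e + size Q; n + i]))) => //.
  rewrite /= /set_creg /= Mq offsetS offset0 subn0 -mE !addn0 -catA.
  by congr Config; rewrite addn1.
apply: runs_seq; first exact: chunk_loop_runs.
apply: runs_seq; first exact: eval_runs.
rewrite /= /set_creg /=; apply: runs_seq; first exact: copy_loop_runs.
apply: runs_seq.
  apply: (@runs_eval _ _ (Config (RG z [:: (p.+1 + size Q).+1; i; c; size D; 1; 0; h; d.+1; G; 0; 0; 0; 0])
     M tp ((((o ++ [:: e + size Q; n + i]) ++ flatten (mkseq (chunk d r n w i) h)) ++ Q) ++
       [:: 10 + W + size D; 1; 0; 0]))) => //.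
  rewrite /= /set_creg /= Md !addn0 -!catA; congr Config; by rewrite addn1.
apply: runs_seq; first exact: chain_loop_runs.
apply: runs_seq.
  apply: (@runs_eval _ _ (Config (RG z [:: (p.+1 + size Q).+1; i; c; size D; 0; W + 2; W + 2 + size D; 0; 0; 0; 0; 0; 0])
     M tp (((((o ++ [:: e + size Q; n + i]) ++ flatten (mkseq (chunk d r n w i) h)) ++ Q) ++
       [:: 10 + W + size D; 1; 0; 0]) ++
       encode_gates (behead (chain d.+1 h (link C))) ++ [:: 1; 0; 0]))) => //.
  by rewrite /= /set_creg /= -!catA.
apply: runs_seq; first exact: shift_loop_runs.
apply: runs_seq; first exact: closing_code_runs.
apply: runs_eval => //; rewrite /fin; execute; congr Config.
  rewrite /encode_test -/Q -/D [size (_ :: _)]/= size_cat [size (_ :: _)]/= subn1 addn1; do ![congr cons].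
  rewrite /= -/(encode_gates D); clear; lia.
have encE : encode_gates (new_decision C d.+1 h D) =
    [:: 1; 0; 0] ++ encode_gates (behead (chain d.+1 h (link C))) ++ [:: 1; 0; 0] ++
    encode_gates (map (shift_gate e (W + 2)) D) ++
    encode_gates (closing (W + 2 + size D) W (1 + h.-1 * d.+1)).
  rewrite /new_decision.
  have -> : chain d.+1 h (link C) = [:: GNand 0 0] ++ behead (chain d.+1 h (link C)) by [].
  by rewrite -[_ :: _ ++ closing _ _ _]cat1s !encode_gates_cat eE WE -/G -!catA.
have sQ : size (queries (new_test d C r h n w i T)) = e + size Q.
  by rewrite size_cat size_extra eE.
rewrite /encode_test sQ.
rewrite [decision (new_test _ _ _ _ _ _ _ _)](_ : _ = new_decision C d.+1 h D) // sND.
rewrite -/(encode_gates _) encE.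
rewrite [queries _](_ : _ = [:: n + i] ++ flatten (mkseq (chunk d r n w i) h) ++ Q) //.
by rewrite -!catA.
Qed.

End Emission.

Lemma runs_if_true x a b s T s' :
  nth 0 (cregs s) x != 0 -> runs a s T s' -> runs (If x a b) s T.+1 s'.
Proof. by move=> x0 [t e l]; exists t.+1 => //; apply: ExecIfTrue. Qed.

Lemma runs_if_false x a b s T s' :
  nth 0 (cregs s) x = 0 -> runs b s T s' -> runs (If x a b) s T.+1 s'.
Proof. by move=> x0 [t e l]; exists t.+1 => //; apply: ExecIfFalse. Qed.

(** * Correctness of the wiring table *)

Section Table.
Variables (d L r n h : nat) (w : seq bool).
Hypothesis hr : h <= r.
Let m2 := 2 ^ r + 2 ^ r.

Lemma layer_writesP (p : nat * nat) :
  reflect (exists k g j, [/\ k < h, g < 2 ^ (r - k).-1, j < d &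
     p = (L + (offset r n k.+1 + g) + j * m2,
          nth 0 (nth [::] (wiring d r w k) g) j + offset r n k)])
  (p \in flatten (mkseq (layer_writes d L r n m2 w) h)).
Proof.
apply: (iffP flattenP) => [[ws /mapP [k]]|[k [g [j [kh gk jd pE]]]]].
  rewrite mem_iota => /andP [_ kh] -> /flattenP [ws' /mapP [g]].
  rewrite mem_iota => /andP [_ gk] -> /mapP [j]; rewrite mem_iota => /andP [_ jd] ->.
  by exists k, g, j; split => //; rewrite nth_wiring // nth_draws.
exists (layer_writes d L r n m2 w k).
  by apply: map_f; rewrite mem_iota.
apply/flattenP; exists (row_writes d m2 (L + (offset r n k.+1 + g)) (offset r n k) (r - k)
    (drop (g * (d * (r - k))) (tape_at d r k w))).
  by apply: map_f; rewrite mem_iota.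
apply/mapP; exists j; first by rewrite mem_iota.
by rewrite pE nth_wiring // nth_draws.
Qed.

Lemma writes_input M x : x < L ->
  writes M (flatten (mkseq (layer_writes d L r n m2 w) h)) x = M x.
Proof.
move=> xL; apply: writes_notin => p /layer_writesP [k [g [j [_ _ _ ->]]]] /=.
by rewrite gtn_eqF //; lia.
Qed.

Lemma writes_table M k g j : k < h -> g < 2 ^ (r - k.+1) -> j < d ->
  writes M (flatten (mkseq (layer_writes d L r n m2 w) h))
    (offset r n k.+1 + g + L + j * m2) =
  offset r n k + nth 0 (nth [::] (wiring d r w k) g) j.
Proof.
move=> kh gk jd; have rk k' : (r - k').-1 = r - k'.+1 by lia.
have bnd k' g' : k' < h -> g' < 2 ^ (r - k'.+1) ->
    n <= offset r n k'.+1 + g' < n + m2 /\ offset r n k'.+1 + g' < offset r n k'.+2.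
  move=> kh' gk'; have lt : offset r n k'.+1 + g' < offset r n k'.+2.
    by rewrite [offset _ _ k'.+2]offsetS ltn_add2l.
  split=> //; apply/andP; split.
    apply: leq_trans (leq_addr _ _); rewrite -{1}(offset0 r n); exact: offset_le.
  apply: leq_trans lt _; rewrite /m2 addnn -mul2n -expnS.
  by rewrite -(@offsetE r n k'.+2) ?leq_addr //; lia.
have [b1 b2] := bnd _ _ kh gk.
apply: writes_in.
  apply/layer_writesP; exists k, g, j; rewrite rk; split => //.
  by congr pair; lia.
move=> p /layer_writesP [k' [g' [j' [kh']]]]; rewrite rk => gk' jd' -> /= eqa.
have [b1' b2'] := bnd _ _ kh' gk'.
have jj : j' = j.
  case: (ltngtP j' j) => // jj.
    have := leq_mul jj (leqnn m2); rewrite mulSn; lia.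
  have := leq_mul jj (leqnn m2); rewrite mulSn; lia.
rewrite jj in eqa *.
have zz : offset r n k'.+1 + g' = offset r n k.+1 + g by lia.
have kk : k' = k.
  case: (ltngtP k' k) => // kk.
    have : offset r n k'.+2 <= offset r n k.+1 by apply: offset_le.
    lia.
  have : offset r n k.+2 <= offset r n k'.+1 by apply: offset_le.
  lia.
rewrite kk in zz *; have -> : g' = g by lia.
exact: addnC.
Qed.

End Table.

(** * The complete program and its running time *)

Section Program.
Variables (d r0 : nat) (C : seq gate).

Definition small_test_code : com :=
  seqs [:: Emit 9; Emit 12; If 12 (seqs [:: Emit 1; Emit 9; Emit 9]) Skip].

(** For at most one coin there are one or two tests, and [If 2] emits the second exactly when the
    coin exists. *)
Definition small_code : com :=
  seqs [:: Toss 12; Emit 2; Emit 3; small_test_code; If 2 small_test_code Skip].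

Definition depth_code : com :=
  seqs [:: seqs [:: Const 11 r0; Add 12 2 1; SubC 11 12 11];
    If 11 (seqs [:: seqs [:: Const 13 2; Const 6 0; SubC 14 12 13];
                    While 14 (seqs [:: Add 6 6 1; Add 13 13 13; SubC 14 12 13]);
                    Const 13 0])
          (Const 6 1);
    seqs [:: Const 11 0; Const 12 0]].

Lemma depth_code_runs L r n m M tp o X : 0 < r -> r <= X ->
  runs depth_code
    (Config [:: L; 1; r; n; m; m + m; 0; 0; 0; 0; 0; 0; 0; 0; 0; 0; 0; 0; 0; 0; 0; 0; 0; 0] M tp o)
    (15 * X)
    (Config [:: L; 1; r; n; m; m + m; depth r0 r; 0; 0; 0; 0; 0; 0; 0; 0; 0; 0; 0; 0; 0; 0; 0; 0; 0] M tp o).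
Proof.
move=> r_gt0 rX.
have lg : trunc_log 2 r < X.
  apply: leq_trans rX; apply: leq_trans (ltn_expl _ (ltnSn 1)) _.
  exact: trunc_logP.
apply: (@runs_le _ _ (3 + ((3 + (trunc_log 2 r * 4 + 1 + 1)).+1 + 2))); first by lia.
apply: runs_seq; first exact: eval_runs.
execute; rewrite /depth; apply: (@runs_seq _ _ _ _ (Config [:: L; 1; r; n; m; m + m; depth r0 r; 0; 0; 0; 0; r + 1 - r0; r + 1; 0; 0; 0; 0; 0; 0; 0; 0; 0; 0; 0] M tp o)); last exact: eval_runs.
rewrite /depth; case: ifPn => rr0.
  by apply: runs_if_false => /=; [lia | apply: (@runs_eval (Const 6 1)) => //; lia].
apply: runs_if_true => /=; first by lia.
pose F i := Config [:: L; 1; r; n; m; m + m; i; 0; 0; 0; 0; r + 1 - r0; r + 1; 2 ^ i.+1; r + 1 - 2 ^ i.+1; 0; 0; 0; 0; 0; 0; 0; 0; 0] M tp o.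
apply: (@runs_seq _ _ _ _ (F 0)); first exact: eval_runs.
have lastz : r + 1 - 2 ^ (trunc_log 2 r).+1 = 0.
  by have := @trunc_log_ltn 2 r isT; lia.
apply: (@runs_seq _ _ _ _ (F (trunc_log 2 r))); last first.
  by apply: (@runs_eval (Const 13 0)) => //; rewrite /F lastz.
apply: (@runs_while 14 _ F _ 3) => //.
  move=> i il /=.
  have : 2 ^ i.+1 <= r by apply: leq_trans (@trunc_logP 2 r isT r_gt0); rewrite leq_exp2l.
  lia.
move=> i il; apply: runs_eval => //; rewrite /F; execute.
by have -> : 2 ^ i.+1 + 2 ^ i.+1 = 2 ^ i.+2; [rewrite addnn -mul2n -expnS | rewrite addn1].
Qed.

Definition size_code : com :=
  seqs [:: seqs [:: Const 7 1; Add 11 6 9; Const 12 d.+1; Const 13 (size (link C))];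
           While 11 (seqs [:: Add 7 7 12; Add 8 8 13; SubC 11 11 1]);
           seqs [:: Const 12 0; Const 13 0]].

Lemma size_code_runs L r n m h M tp o :
  runs size_code
    (Config [:: L; 1; r; n; m; m + m; h; 0; 0; 0; 0; 0; 0; 0; 0; 0; 0; 0; 0; 0; 0; 0; 0; 0] M tp o)
    (h * 4 + 7)
    (Config [:: L; 1; r; n; m; m + m; h; 1 + h * d.+1; h * size (link C); 0; 0; 0; 0; 0; 0; 0; 0; 0; 0; 0; 0; 0; 0; 0] M tp o).
Proof.
set G := size (link C).
pose F i := Config [:: L; 1; r; n; m; m + m; h; 1 + i * d.+1; i * G; 0; 0; h - i; d.+1; G; 0; 0; 0; 0; 0; 0; 0; 0; 0; 0] M tp o.
apply: (@runs_le _ _ (4 + (h * 4 + 1 + 2))); first by lia.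
apply: (@runs_seq _ _ _ _ (F 0)).
  by apply: runs_eval => //; rewrite /F; execute; rewrite addn0 subn0.
apply: (@runs_seq _ _ _ _ (F h)); last first.
  by apply: runs_eval => //; rewrite /F; execute; rewrite subnn.
apply: (@runs_for 11 _ F _ 3) => // i ih.
by apply: runs_eval => //; rewrite /F; execute; congr Config; do ![congr cons]; rewrite ?mulSn; lia.
Qed.

Definition main_code : com :=
  seqs [:: Add 11 2 9; pow2 4 11; Add 5 4 4; depth_code; size_code;
           seqs [:: Add 10 3 4; Add 11 3 9; Add 12 2 9; Add 13 6 9];
           layer_loop d;
           seqs [:: Emit 2; Emit 10; Const 11 2; Const 12 0; Add 13 4 9];
           While 13 (test_code d C)].

Definition program : com :=
  Seq (seqs [:: Const 1 1; Fetch 2 9; Fetch 3 1; SubC 11 2 1])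
      (If 11 main_code small_code).

Definition time_factor : nat := 30 * d + 7 * size (link C) + 250.

Lemma encode_new_instance h I w (T0 : test) :
  let r := coins I in let n := proof_size I in
  encode (new_instance d C h I w) =
  r :: offset r n h.+1 ::
  flatten (mkseq (fun i => encode_test (new_test d C r h n w i
    (nth T0 [seq test_of rho | rho <- enum {: r.-tuple bool}] i))) (2 ^ r)).
Proof.
move=> r n; pose rho0 := [tuple of nseq r false].
pose f (rho : r.-tuple bool) :=
  encode_test (new_test d C r h n w (test_index rho) (test_of rho)).
have -> : encode (new_instance d C h I w) =
    r :: offset r n h.+1 :: flatten (map f (enum {: r.-tuple bool})) by [].
congr [:: _, _ & flatten _].
apply: (@eq_from_nth _ [::]); rewrite size_map ?size_mkseq -cardE card_bits // => i ir.
have ic : i < #|{: r.-tuple bool}| by rewrite card_bits.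
have ie : i < size (enum {: r.-tuple bool}) by rewrite -cardE.
rewrite (nth_map rho0 [::] f ie) nth_mkseq // (nth_map rho0 T0 _ ie) /f; congr (encode_test (new_test _ _ _ _ _ _ _ _)).
by rewrite /test_index -(enum_val_nth rho0 (Ordinal ic)) enum_valK.
Qed.

Lemma main_code_runs I w X :
  let r := coins I in let n := proof_size I in let xs := encode I in
  1 < r -> size xs <= X ->
  exists s, [/\ runs main_code
    (Config [:: size xs; 1; r; n; 0; 0; 0; 0; 0; 0; 0; r - 1; 0; 0; 0; 0; 0; 0; 0; 0; 0; 0; 0; 0] (nth 0 xs) w [::])
    (time_factor * X ^ 3) s & cout s = encode (new_instance d C (depth r0 r) I w)].
Proof.
move=> r n xs r1 xsX; set L := size xs; set h := depth r0 r; set G := size (link C).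
pose ts := [seq test_of rho | rho <- enum {: r.-tuple bool}].
have sts : size ts = 2 ^ r by rewrite size_map -cardE card_bits.
have xsE : xs = [:: r; n] ++ flatten (map encode_test ts).
  by rewrite /ts -map_comp.
(* Even a trivial test is encoded by two numbers (its two lengths), so the input has more than
   [2 ^ r] entries and [X] bounds [2 ^ r]. *)
have sflat (t : seq test) : 2 * size t <= size (flatten (map encode_test t)).
  elim: t => //= T t IH; rewrite size_cat /= size_cat /=; lia.
have rX : 2 ^ r <= X.
  apply: leq_trans xsX; rewrite xsE size_cat; have := sflat ts; rewrite sts /=; lia.
have rX' : r < X by apply: leq_trans rX; apply: ltn_expl.
have h0 : 0 < h := depth_gt0 r0 r1.
have hr : h <= r by apply/ltnW/depth_lt.
have X0 : 0 < X by lia.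
pose m := 2 ^ r; pose e := 1 + h * d.+1; pose W := h * G.
pose M := writes (nth 0 xs) (flatten (mkseq (layer_writes d L r n (m + m) w) h)).
pose tp := tape_at d r h w; pose T0 := Test [::] [::].
pose pos i := 2 + size (flatten (map encode_test (take i ts))).
pose F i := Config [:: L; 1; r; n; m; m + m; h; e; W; 0; offset r n h.+1;
   pos i; i; m - i; 0; 0; 0; 0; 0; 0; 0; 0; 0; 0] M tp
   ([:: r; offset r n h.+1] ++ flatten (mkseq (fun j =>
      encode_test (new_test d C r h n w j (nth T0 ts j))) i)).
exists (F m); split; last by rewrite (encode_new_instance _ _ _ T0).
apply: (@runs_le _ _ (1 + (r * 3 + 2 + (1 + (15 * X + (h * 4 + 7 + (4 +
  ((15 * d + 20) * X ^ 3 + (5 +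
   (m * ((6 * d + 7 * G + 130) * X ^ 2).+1 + 1)))))))))).
  have mX : m * ((6 * d + 7 * G + 130) * X ^ 2).+1 <=
            (6 * d + 7 * G + 130) * X ^ 3 + X.
    rewrite mulnS addnC; apply: leq_add => //.
    by rewrite [X ^ 3]expnS mulnCA; apply: leq_mul => //; apply: leq_mul.
  have XY : X <= X ^ 3 by rewrite -{1}[X]expn1 leq_pexp2l.
  move: mX XY; rewrite /time_factor -/G; move: (X ^ 3) (m * _) => Y Z ZY XY.
  clear -ZY XY rX' hr X0; lia.
apply: runs_seq; first exact: eval_runs.
apply: runs_seq; first by apply: pow2_runs => //=; rewrite addn0.
apply: runs_seq; first exact: eval_runs.
execute; apply: runs_seq; first by apply: depth_code_runs; lia.
apply: runs_seq; first exact: size_code_runs.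
apply: runs_seq.
  apply: (@runs_eval _ _ (Config [:: L; 1; r; n; m; m + m; h; e; W; 0; offset r n 1;
     n; r; h; 0; 0; 0; 0; 0; 0; 0; 0; 0; 0] (nth 0 xs) w [::])) => //.
  by execute; rewrite offsetS offset0 subn0 !addn0.
apply: runs_seq; first by apply: layer_loop_runs.
apply: (@runs_seq _ _ _ _ (F 0)).
  apply: runs_eval => //; rewrite /F; execute.
  by rewrite /pos take0 subn0 addn0.
apply: (@runs_for 13 _ F) => // i im.
have its : i < size ts by rewrite sts.
have tsE : ts = take i ts ++ [:: nth T0 ts i] ++ drop i.+1 ts.
  by rewrite cat1s -drop_nth // cat_take_drop.
have xsE' : xs = ([:: r; n] ++ flatten (map encode_test (take i ts))) ++
     encode_test (nth T0 ts i) ++ flatten (map encode_test (drop i.+1 ts)).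
  by rewrite xsE {1}tsE !map_cat !flatten_cat /= cats0.
have ML x : x < L -> M x = nth 0 xs x by apply: writes_input.
have Mi : mem_at M (pos i) (encode_test (nth T0 ts i)).
  move=> x xs'.
  have pE : pos i = size ([:: r; n] ++ flatten (map encode_test (take i ts))) by rewrite size_cat.
  rewrite ML; last by rewrite /L xsE' !size_cat pE size_cat; lia.
  rewrite xsE' pE; move: ([:: r; n] ++ _) => A.
  by rewrite nth_cat ltnNge leq_addr addKn nth_cat xs'.
have sT : size (encode_test (nth T0 ts i)) <= X.
  by apply: leq_trans xsX; rewrite {1}xsE' !size_cat; lia.
have [qX DX] : size (queries (nth T0 ts i)) <= X /\ size (decision (nth T0 ts i)) <= X.
  move: sT; rewrite /encode_test /= size_cat /=.
  rewrite -/(encode_gates _) size_encode_gates; lia.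
have := @test_code_runs d C L r n m h e W M w _ (offset r n h.+1) (pos i) i (m - i)
   (nth T0 ts i) tp ([:: r; offset r n h.+1] ++ flatten (mkseq (fun j =>
      encode_test (new_test d C r h n w j (nth T0 ts j))) i)) X.
have -> : F i.+1 = Config [:: L; 1; r; n; m; m + m; h; e; W; 0; offset r n h.+1;
    pos i + size (encode_test (nth T0 ts i)); i.+1; (m - i).-1; 0; 0; 0; 0; 0; 0; 0; 0; 0; 0] M tp
  (([:: r; offset r n h.+1] ++ flatten (mkseq (fun j =>
      encode_test (new_test d C r h n w j (nth T0 ts j))) i)) ++
      encode_test (new_test d C r h n w i (nth T0 ts i))).
  rewrite /F mkseqS flatten_rcons catA; congr Config.
  have -> : pos i.+1 = pos i + size (encode_test (nth T0 ts i)).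
    by rewrite /pos (take_nth T0) // map_rcons flatten_rcons size_cat addnA.
  by have -> : m - i.+1 = (m - i).-1 by lia.
apply=> // k g j kh gk jd.
exact: writes_table.
Qed.

End Program.

(** * The reduction *)

(** The single gate reads missing wires and accepts; the empty circuit rejects. *)
Definition coin_instance (I : instance) (b : bool) : instance :=
  Instance (proof_size I)
    (fun _ : (coins I).-tuple bool => Test [::] (if b then [:: GNand 0 0] else [::])).

Lemma size_le_bit_size xs : size xs <= bit_size xs.
Proof. by rewrite /bit_size -sum1_size leq_sum. Qed.

Lemma size_encode I : 2 * 2 ^ coins I < size (encode I).
Proof.
rewrite /= ltnS; apply: leqW.
rewrite -card_bits cardE; elim: (enum _) => //= rho s IH.
rewrite size_cat /= size_cat /=; lia.
Qed.

(** Time bounds carry no leading constant, so the factor [K] is absorbed into the degree through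
    [K < X ^ K]. *)
Lemma poly_bound K X : 1 < X -> K * X ^ 3 + X ^ 3 <= X ^ (K + 3).
Proof.
move=> X1; rewrite expnD -mulSnr leq_mul //.
exact: ltn_expl.
Qed.

Section Reduction.
Variables (d r0 : nat) (C : seq gate).

Definition reduction (I : instance) (w : seq bool) : instance :=
  if coins I <= 1 then coin_instance I (head false w)
  else new_instance d C (depth r0 (coins I)) I w.

Definition degree : nat := time_factor d C + 3.

Lemma small_code_runs I w : coins I <= 1 ->
  exists s, runs small_code
    (Config [:: size (encode I); 1; coins I; proof_size I; 0; 0; 0; 0; 0; 0; 0; coins I - 1; 0; 0; 0; 0; 0; 0; 0; 0; 0; 0; 0; 0]
       (nth 0 (encode I)) w [::]) 20 s /\
    cout s = encode (coin_instance I (head false w)).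
Proof.
move=> r1; eexists; split; first by apply: (@runs_le _ _ (cost small_code)) => //; apply: eval_runs.
set b := head false w.
have -> : encode (coin_instance I b) = coins I :: proof_size I ::
    flatten (nseq (2 ^ coins I) (encode_test (Test [::] (if b then [:: GNand 0 0] else [::])))).
  rewrite /encode -card_bits cardE; congr [:: _, _ & flatten _].
  by elim: (enum _) => //= rho s ->.
case: (coins I) r1 => [|[|//]] _; rewrite /small_code /small_test_code; execute; rewrite -/b;
  by case: b.
Qed.

Lemma reduction_correct (I : instance) (w : (time_bound degree I).-tuple bool) :
  exists t st, [/\ exec (program d r0 C) (init (encode I) w) t st,
                   t <= time_bound degree I & out st = encode (reduction I w)].
Proof.
set X := bit_size (encode I); set xs := encode I.
have X1 : 1 < X.
  apply: leq_trans (size_le_bit_size _); apply: leq_trans (size_encode I).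
  by have := expn_gt0 2 (coins I); lia.
have iE : init xs w = state_of (Config (size xs :: nseq 23 0) (nth 0 xs) w [::]).
  rewrite /init /state_of /=; congr State; apply/funext => y.
  by rewrite /upd; case: y => //= y; do 23?[case: y => //= y]; rewrite nth_nil.
have setup := @eval_runs (seqs [:: Const 1 1; Fetch 2 9; Fetch 3 1; SubC 11 2 1])
   (Config (size xs :: nseq 23 0) (nth 0 xs) w [::]) isT.
suff [s [ex so]] : exists s, runs (program d r0 C) (Config (size xs :: nseq 23 0) (nth 0 xs) w [::])
     (time_bound degree I) s /\ cout s = encode (reduction I w).
  by have [t e l] := ex; exists t, (state_of s); split; rewrite ?iE.
rewrite /reduction; case: ifPn => r1.
  have [s [rs so]] := small_code_runs w r1; exists s; split=> //.
  apply: (@runs_le _ _ (4 + 21)).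
    by apply: leq_trans (leq_addr _ _); rewrite /degree /time_factor; lia.
  apply: runs_seq setup _; apply: runs_if_false; first by rewrite /=; lia.
  exact: rs.
rewrite -ltnNge in r1.
have [s [rs so]] := @main_code_runs d r0 C I w X r1 (size_le_bit_size _).
exists s; split=> //.
apply: (@runs_le _ _ (4 + (time_factor d C * X ^ 3).+1)).
  rewrite /time_bound -/X /degree.
  have := poly_bound (time_factor d C) X1; rewrite {4}/time_factor; lia.
apply: runs_seq setup _; apply: runs_if_true; last exact: rs.
by rewrite /=; lia.
Qed.

Definition reduction_map : rptime_map := RPTimeMap reduction_correct.

(** Guarantees that every wiring bit is a genuine random bit and not the default read from an
    exhausted tape. *)
Lemma tape_long_enough I : 1 < coins I ->
  \sum_(j < depth r0 (coins I)) layer_bits d (coins I - j) <= time_bound degree I.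
Proof.
move=> r1; set r := coins I; set X := bit_size (encode I).
have rX : 2 ^ r <= X.
  by apply: leq_trans (size_le_bit_size _); have := size_encode I; rewrite -/r; lia.
have rX' : r < X by apply: leq_trans rX; apply: ltn_expl.
apply: (@leq_trans (d * X ^ 3)).
  apply: (@leq_trans (\sum_(j < depth r0 r) d * X ^ 2)).
    apply: leq_sum => j _; apply: leq_trans (layer_bits_le d (leq_subr j r)) _.
    by rewrite -mulnA leq_mul // expnS expn1 leq_mul // ltnW.
  rewrite sum_nat_const card_ord mulnCA leq_mul // [X ^ 3]expnS leq_mul //.
  by apply: ltnW; apply: leq_trans (depth_lt r0 r1) (ltnW rX').
have X1 : 1 < X by lia.
have := poly_bound (time_factor d C) X1; rewrite /time_bound -/X /degree.
have : d * X ^ 3 <= time_factor d C * X ^ 3 by rewrite leq_mul // /time_factor; lia.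
lia.
Qed.

End Reduction.

Lemma avg_head (R : realType) n : 0 < n ->
  (avg n (fun w => (head false w)%:R) = 2^-1 :> R /\
   avg n (fun w => (~~ head false w)%:R) = 2^-1 :> R)%R.
Proof. by case: n => // n _ /=; rewrite !avg_const; split; lra. Qed.

Lemma Pr_ge (R : realType) n (P : seq bool -> Prop) (B : pred (seq bool)) (p : R) :
  (forall w, size w = n -> ~~ B w -> P w) -> (avg n (fun w => (B w)%:R) <= p)%R ->
  (1 - p <= Pr R (fun w : n.-tuple bool => P w))%R.
Proof.
move=> BP Bp; rewrite Pr_avg lerBlDr.
apply: le_trans (lerD (lexx _) Bp); rewrite -avgD.
rewrite -[X in (X <= _)%R](avg_const n); apply: avg_le => w sw.
case: (boolP (B w)) => [_|/(BP w sw) Pw]; first by rewrite lerDr.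
by rewrite (asboolT Pw) addr0.
Qed.

Theorem theorem2 (R : realType) :
  exists (K : nat) (eps : R), (0 < eps)%R /\
  forall c s : R, (0 < c < 1)%R -> (0 < s < 1)%R -> (s < c)%R ->
  exists (s' : R) (C : nat), (0 < s' < 1)%R /\
  forall r q : nat -> nat,
  exists A : rptime_map,
    pcp_reduction A c s r q 1%R s' r
      (fun n => q n + C * trunc_log 2 (r n))
      (fun n => powR 2%R (- (eps * (r n)%:R))%R)
    /\
    forall V : verifier, restricted r q V ->
    forall (x : seq bool) (w : (rp_coins A (V x)).-tuple bool),
      proof_size (A (V x) w) <= proof_size (V x) + K * 2 ^ r (size x).
Proof.
(* The appended levels have geometrically decreasing sizes with sum below [2 * 2 ^ r], and the error
   is at most [2 ^ - r] itself. *)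
exists 2, 1%R; split=> // c s c01 s01 sc.
have [r0 [d [t [compl sound]]]] := parameters c01 s01 sc.
have [C C0 CE] := circuit_exists d.+1
  (fun b => nth false b 0 ==> (t <= count id (behead b))).
have CE' a : circuit_eval a C =
    (nth false a 0 ==> (t <= count id (mkseq (fun j => nth false a j.+1) d))).
  by rewrite CE /= /mkseq (iotaDl 1 0) -map_comp.
set eta := ((c - s) / 4)%R in sound.
have /andP [c0 c1] := c01; have /andP [s0 s1] := s01.
(* Each level costs [d.+1] queries; the one further query, to the claimed verdict, is absorbed by
   raising [d.+1] to [d.+2], since [trunc_log 2 r >= 1] for [r > 1]. *)
exists (1 - eta)%R, d.+2; split; first by apply/andP; rewrite /eta; split; lra.
move=> r q; exists (reduction_map d r0 C).
have sizeP (V : verifier) : restricted r q V -> forall (x : seq bool) w,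
   proof_size (reduction d r0 C (V x) w) <= proof_size (V x) + 2 * 2 ^ r (size x).
  move=> rV x w; have [rE _] := rV x; rewrite /reduction; case: ifPn => r1.
    exact: leq_addr.
  rewrite -ltnNge in r1; rewrite /= -rE -expnS.
  rewrite -(@offsetE (coins (V x)) (proof_size (V x)) (depth r0 (coins (V x))).+1).
    exact: leq_addr.
  by rewrite ltnS ltnW // depth_lt.
split; last by move=> V rV x w; apply: sizeP.
move=> V rV x; have := rV x; move: (V x) => I rI.
have [rE qI] := rI.
have pE : powR 2%R (- (1 * (r (size x))%:R))%R = (2^-1 ^+ coins I)%R :> R.
  by rewrite mul1r powRN powR_mulrn // rE exprVn.
rewrite pE /rp_coins /=; set N := time_bound _ I.
have [r1|r1] := leqP (coins I) 1.
  have redE w : reduction d r0 C I w = coin_instance I (head false w).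
    by rewrite /reduction r1.
  have N0 : 0 < N by rewrite /N /time_bound /degree; lia.
  have [h1 h2] := avg_head R N0.
  have half : (2^-1 <= 2^-1 ^+ coins I :> R)%R.
    by rewrite -{1}[2^-1%R]expr1; apply: ler_wiXn2l => //; lra.
  split.
  - by move=> w; rewrite redE; split.
  - move=> _; apply: (@Pr_ge _ _ (fun w => completeness_ge 1%R (reduction d r0 C I w))
        (fun w => ~~ head false w)); last by rewrite h2.
    move=> w _; rewrite negbK redE => ->.
    exists [tuple of nseq _ false].
    rewrite /Pr (_ : [set _ | _] = setT); last first.
      by apply/setP => rho; rewrite !inE; apply/asboolP.
    by rewrite cardsT divff // pnatr_eq0 card_bits expn_eq0.
  - move=> _; apply: (@Pr_ge _ _ (fun w => soundness_le (1 - eta)%R (reduction d r0 C I w))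
        (head false)); last by rewrite h1.
    move=> w _; rewrite redE => /negPf -> P.
    rewrite /Pr (_ : [set _ | _] = set0); last first.
      by apply/setP => rho; rewrite !inE; apply/asboolP.
    by rewrite cards0 mul0r /eta; lra.
have redE w : reduction d r0 C I w = new_instance d C (depth r0 (coins I)) I w.
  by rewrite /reduction leqNgt r1.
have h0 := depth_gt0 r0 r1; have hr := ltnW (depth_lt r0 r1).
have hN := tape_long_enough d r0 C r1.
have qlt rho := proj2 (qI rho).
split.
- move=> w; rewrite redE.
  have [e1 e2] := new_instance_restricted d C (depth r0 (coins I)) w rI.
  split=> // rho; have [f1 f2] := e2 rho; split=> //.
  apply: leq_trans f1 _; rewrite leq_add2l -rE.
  have := depth_le_log r0 r1; nia.
- case=> P cP.
  apply: (@Pr_ge _ _ (fun w => completeness_ge 1%R (reduction d r0 C I w))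
    (fun w => 0 < ones (predC (level d t (coins I) (sat_at I P) w (depth r0 (coins I))))
                  (2 ^ (coins I - depth r0 (coins I))))).
    move=> w _; rewrite lt0n negbK => /eqP z; rewrite redE.
    exact: (new_instance_complete C0 CE' R qlt h0 z).
  apply: compl => //; move: cP.
  have -> : Pr R (fun rho : (coins I).-tuple bool => accepts P (test_of rho)) =
     Pr R (fun rho : (coins I).-tuple bool => sat_at I P (test_index rho)).
    rewrite /Pr; congr (_%:R / _)%R; apply: eq_card => rho; rewrite !inE.
    by apply: asbool_equiv_eq; rewrite sat_at_index.
  by rewrite Pr_test_index ler_pdivlMr ?exprn_gt0.
- move=> sI.
  apply: (@Pr_ge _ _ (fun w => soundness_le (1 - eta)%R (reduction d r0 C I w))
    (fun w => `[< exists2 k, k < depth r0 (coins I) &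
        ~ sampling (s + eta)%R s t (coins I - k) (wiring d (coins I) w k) >])).
    move=> w _ /asboolPn nb; rewrite redE.
    apply: (new_instance_sound C0 CE' qlt h0 hr _ _ sI); last by rewrite /eta; lra.
    by move=> k kh; apply: contrapT => ns; apply: nb; exists k.
  exact: sound.
Qed.
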